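(* Let $$F(x,q)=\sum_{\text{planar }(T,S,\phi)}x^{\text{size}(T,S,\phi)}q^{|\{\text{leaf-matched pairs of }(T,S,\phi)\}|},\qquad H(x)=\sum_{\text{irreducible planar }(T,S,\phi)}x^{\text{size}(T,S,\phi)},$$ where the sums are over isomorphism classes of tanglegrams and where, by convention, the coefficient of $x^2$ in $H(x)$ is taken to be $\tfrac12$. Then $$F(x,q)=x+q\cdot H(F(x,q))+\frac{q\cdot F(x^2,q^2)}{2}.$$
   Context: A rooted binary tree is a rooted tree in which every vertex has zero or two children; vertices with children are internal, the others are leaves. A tanglegram $(T,S,\phi)$ of size $n$ consists of rooted binary trees $T,S$ with leaves $t_1,\dots,t_n$ and $s_1,\dots,s_n$ and a bijection $\phi:[n]\to[n]$ matching $t_i$ with $s_{\phi(i)}$; $\text{size}(T,S,\phi)=n$ is the common number of leaves. Tanglegrams are considered up to isomorphism: replacing $T$ and $S$ by isomorphic rooted trees (children are unordered) or relabeling vertices, with $\phi$ modified accordingly, does not give a new tanglegram; $T$ is the first tree and $S$ the second tree. A layout is a pair $(X,Y)$ of ordered lists of the leaves of $T$ and of $S$ in which the leaves below each vertex appear consecutively; $(t_i,s_{\phi(i)})$ and $(t_j,s_{\phi(j)})$ cross if the relative order of $t_i,t_j$ in $X$ is opposite to that of $s_{\phi(i)},s_{\phi(j)}$ in $Y$. A tanglegram is planar if it has a layout with no crossings. A leaf-matched pair is a pair $(u,v)$ of internal vertices $u\in T$, $v\in S$ such that the leaves descending from $u$ are exactly those matched by $\phi$ with the leaves descending from $v$.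 When the size is at least $2$, the two roots form a leaf-matched pair; a tanglegram (of size at least 2) is irreducible if this is its only leaf-matched pair. The size-1 tanglegram has no leaf-matched pairs and contributes $x$ to $F$. *)

(* Defs.v *)
From HB Require Import structures.
From mathcomp Require Import all_boot all_order all_fingroup all_algebra.

Set Implicit Arguments.
Unset Strict Implicit.
Unset Printing Implicit Defensive.

Import GRing.Theory.

(* Rooted binary trees with leaves labelled by L.  Since Node is ordered, this
   is a plane representation; [tree_sim] below forgets the order of children. *)
Inductive btree (L : Type) : Type :=
| Leaf of L
| Node of btree L & btree L.

Section BTree.
Variable L : Type.
Implicit Types T : btree L.

Fixpoint leaves T : seq L :=
  match T with
  | Leaf a => [:: a]
  | Node l r => leaves l ++ leaves r
  end.

(* A vertex is represented by the subtree it is the root of; the list has one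
   entry per vertex. *)
Fixpoint vertices T : seq (btree L) :=
  match T with
  | Leaf _ => [:: T]
  | Node l r => T :: vertices l ++ vertices r
  end.

Definition is_internal T : bool := if T is Node _ _ then true else false.

Definition internal_vertices T : seq (btree L) :=
  [seq u <- vertices T | is_internal u].

Fixpoint relabel (L' : Type) (f : L -> L') T : btree L' :=
  match T with
  | Leaf a => Leaf (f a)
  | Node l r => Node (relabel f l) (relabel f r)
  end.

Fixpoint gtree_of T : GenTree.tree L :=
  match T with
  | Leaf a => GenTree.Leaf a
  | Node l r => GenTree.Node 0 [:: gtree_of l; gtree_of r]
  end.

Fixpoint of_gtree (t : GenTree.tree L) : option (btree L) :=
  match t with
  | GenTree.Leaf a => Some (Leaf a)
  | GenTree.Node _ [:: l; r] =>
      match of_gtree l, of_gtree r with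
      | Some l', Some r' => Some (Node l' r')
      | _, _ => None
      end
  | _ => None
  end.

Lemma gtree_ofK : pcancel gtree_of of_gtree.
Proof. by elim=> //= l -> r ->. Qed.

Lemma size_leaves_gt0 T : 0 < size (leaves T).
Proof. by elim: T => //= l IHl r _; rewrite size_cat addn_gt0 IHl. Qed.

End BTree.

HB.instance Definition _ (L : eqType) :=
  Equality.copy (btree L) (pcan_type (@gtree_ofK L)).
HB.instance Definition _ (L : choiceType) :=
  Choice.copy (btree L) (pcan_type (@gtree_ofK L)).
HB.instance Definition _ (L : countType) :=
  Countable.copy (btree L) (pcan_type (@gtree_ofK L)).

(* Equality of leaf-labelled rooted trees when children are unordered, i.e. the
   existence of a rooted-tree isomorphism that fixes the leaf labels. *)
Fixpoint tree_sim (L : eqType) (T T' : btree L) : bool :=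
  match T, T' with
  | Leaf a, Leaf b => a == b
  | Node l r, Node l' r' =>
      (tree_sim l l' && tree_sim r r') || (tree_sim l r' && tree_sim r l')
  | _, _ => false
  end.

Section TreeSim.
Variable L : eqType.
Implicit Types T : btree L.

Lemma tree_sim_refl : reflexive (@tree_sim L).
Proof. by elim=> [a|l IHl r IHr] /=; rewrite ?eqxx // IHl IHr. Qed.

Lemma tree_sim_sym : symmetric (@tree_sim L).
Proof.
elim=> [a|l IHl r IHr] [b|l' r'] //=.
by rewrite !IHl !IHr [tree_sim r' l && _]andbC.
Qed.

Lemma tree_sim_trans : transitive (@tree_sim L).
Proof.
move=> T2 T1 T3; elim: T2 T1 T3 => [b|l IHl r IHr] [a|l1 r1] [c|l3 r3] //=.
  by move=> /eqP-> /eqP->.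
by case/orP=> /andP[h1 h2] /orP[] /andP[h3 h4]; apply/orP;
   [left|right|right|left]; apply/andP; split;
   (exact: IHl h1 h3 || exact: IHl h1 h4 || exact: IHr h1 h4 || exact: IHr h1 h3
    || exact: IHr h2 h4 || exact: IHr h2 h3 || exact: IHl h2 h3
    || exact: IHl h2 h4).
Qed.

End TreeSim.

Lemma tree_sim_relabel (L L' : eqType) (f : L -> L') (T T' : btree L) :
  tree_sim T T' -> tree_sim (relabel f T) (relabel f T').
Proof.
elim: T T' => [a|l IHl r IHr] [b|l' r'] //=; first by move=> /eqP->.
by case/orP=> /andP[/IHl-> /IHr->]; rewrite ?orbT.
Qed.

Lemma relabel_comp (A B C : Type) (g : B -> C) (f : A -> B) (T : btree A) :
  relabel g (relabel f T) = relabel (g \o f) T.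
Proof. by elim: T => //= l -> r ->. Qed.

Lemma eq_relabel (A B : Type) (f g : A -> B) :
  f =1 g -> relabel f =1 relabel g.
Proof. by move=> fg; elim=> /= [a|l -> r ->]; rewrite ?fg. Qed.

Lemma relabel_id (A : Type) (T : btree A) : relabel id T = T.
Proof. by elim: T => //= l -> r ->. Qed.

Section Sized.
Variable n : nat.

(* Trees with n leaves, each label of 'I_n being used exactly once. *)
Record ltree : predArgType := LTree {
  tree_of :> btree 'I_n;
  ltreeP : perm_eq (leaves tree_of) (enum 'I_n)
}.

HB.instance Definition _ := [isSub for tree_of].
HB.instance Definition _ := [Countable of ltree by <:].

Fixpoint trees_upto (d : nat) : seq (btree 'I_n) :=
  if d is d'.+1 then
    [seq Leaf a | a <- enum 'I_n] ++
    [seq Node l r | l <- trees_upto d', r <- trees_upto d']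
  else [::].

Lemma mem_trees_upto d (T : btree 'I_n) :
  size (leaves T) <= d -> T \in trees_upto d.
Proof.
elim: d T => [|d IHd] T; first by rewrite leqNgt size_leaves_gt0.
case: T => [a|l r] /= szT; rewrite mem_cat.
  by rewrite map_f ?mem_enum.
rewrite size_cat in szT; apply/orP; right; apply: allpairs_f; apply: IHd.
  by rewrite -ltnS (leq_trans _ szT) // -addn1 leq_add2l size_leaves_gt0.
by rewrite -ltnS (leq_trans _ szT) // -add1n leq_add2r size_leaves_gt0.
Qed.

Definition ltree_enum : seq ltree := pmap insub (undup (trees_upto n)).

Lemma ltree_enumP : Finite.axiom ltree_enum.
Proof.
apply: Finite.uniq_enumP; first by rewrite pmap_sub_uniq ?undup_uniq.
move=> T; rewrite mem_pmap_sub mem_undup inE mem_trees_upto //.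
by rewrite (perm_size (ltreeP T)) size_enum_ord.
Qed.

HB.instance Definition _ := isFinite.Build ltree ltree_enumP.

(* Tanglegrams (T, S, phi) of size n, where t_i (resp. s_j) is the leaf of T
   (resp. S) labelled i (resp. j). *)
Record tanglegram : predArgType := Tanglegram {
  fst_tree : ltree;
  snd_tree : ltree;
  matching : {perm 'I_n}
}.

Definition tanglegram_to (t : tanglegram) : ltree * ltree * {perm 'I_n} :=
  (fst_tree t, snd_tree t, matching t).
Definition tanglegram_from (p : ltree * ltree * {perm 'I_n}) : tanglegram :=
  Tanglegram p.1.1 p.1.2 p.2.

Lemma tanglegram_toK : cancel tanglegram_to tanglegram_from.
Proof. by case. Qed.

HB.instance Definition _ :=
  Finite.copy tanglegram (can_type tanglegram_toK).

(* sigma and tau are the bijections induced on the leaves by isomorphisms of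
   rooted trees from T to T' and from S to S'. *)
Definition tg_iso (t t' : tanglegram) : bool :=
  [exists sigma : {perm 'I_n}, exists tau : {perm 'I_n},
    [&& tree_sim (relabel sigma (fst_tree t)) (fst_tree t'),
        tree_sim (relabel tau (snd_tree t)) (snd_tree t')
      & [forall i, matching t' (sigma i) == tau (matching t i)]]].

Lemma tg_isoP t t' :
  reflect (exists sigma tau : {perm 'I_n},
    [/\ tree_sim (relabel sigma (fst_tree t)) (fst_tree t'),
        tree_sim (relabel tau (snd_tree t)) (snd_tree t')
      & forall i, matching t' (sigma i) = tau (matching t i)])
  (tg_iso t t').
Proof.
apply: (iffP existsP) => [[s /existsP[u /and3P[h1 h2 /forallP h3]]]|].
  by exists s, u; split=> // i; apply/eqP.
case=> s [u [h1 h2 h3]]; exists s; apply/existsP; exists u.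
by rewrite h1 h2; apply/forallP=> i; rewrite h3.
Qed.

Lemma tg_iso_refl : reflexive tg_iso.
Proof.
move=> t; apply/tg_isoP; exists 1%g, 1%g.
have id1 : (1%g : {perm 'I_n}) =1 id by move=> i; rewrite perm1.
by split=> [||i]; rewrite ?(eq_relabel id1) ?relabel_id ?tree_sim_refl ?perm1.
Qed.

Let relabel_inv (s : {perm 'I_n}) (T T' : btree 'I_n) :
  tree_sim (relabel s T) T' -> tree_sim (relabel (s^-1)%g T') T.
Proof.
have sK : ((s^-1)%g : {perm 'I_n}) \o s =1 id by move=> i /=; rewrite permK.
move/(tree_sim_relabel (s^-1)%g); rewrite relabel_comp (eq_relabel sK).
by rewrite relabel_id tree_sim_sym.
Qed.

Let relabel_mul (s s' : {perm 'I_n}) (T T' T'' : btree 'I_n) :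
  tree_sim (relabel s T) T' -> tree_sim (relabel s' T') T'' ->
  tree_sim (relabel (s * s')%g T) T''.
Proof.
have sM : s' \o s =1 (s * s')%g by move=> i /=; rewrite permM.
move/(tree_sim_relabel s'); rewrite relabel_comp (eq_relabel sM).
exact: tree_sim_trans.
Qed.

Lemma tg_iso_sym : symmetric tg_iso.
Proof.
suff sym t t' : tg_iso t t' -> tg_iso t' t by move=> t t'; apply/idP/idP=> /sym.
case/tg_isoP=> s [u [h1 h2 h3]]; apply/tg_isoP; exists (s^-1)%g, (u^-1)%g.
split=> [||i]; [exact: relabel_inv | exact: relabel_inv |].
by apply: (@perm_inj _ u); rewrite -h3 !permKV.
Qed.

Lemma tg_iso_trans : transitive tg_iso.
Proof.
move=> t2 t1 t3 /tg_isoP[s [u [h1 h2 h3]]] /tg_isoP[s' [u' [h1' h2' h3']]].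
apply/tg_isoP; exists (s * s')%g, (u * u')%g.
split=> [||i]; [exact: relabel_mul h1'|exact: relabel_mul h2'|].
by rewrite !permM h3' h3.
Qed.

Canonical tg_iso_equiv : equiv_rel tanglegram :=
  EquivRel tg_iso tg_iso_refl tg_iso_sym tg_iso_trans.

Definition tg_class : predArgType := {eq_quot tg_iso}%qT.
HB.instance Definition _ := Quotient.on tg_class.
HB.instance Definition _ := [Finite of tg_class by <:%/].

Definition class_repr (c : tg_class) : tanglegram := generic_quotient.repr c.

Definition consecutive (s X : seq 'I_n) : bool :=
  [exists k : 'I_(size X).+1, perm_eq (take (size s) (drop k X)) s].

(* Orderings of the leaves allowed in a layout. *)
Definition leaf_order (T : btree 'I_n) (X : seq 'I_n) : bool :=
  perm_eq X (leaves T) && all (fun u => consecutive (leaves u) X) (vertices T).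

(* Opposite relative order of t_i, t_j in X and of their partners in Y. *)
Definition crosses (phi : {perm 'I_n}) (X Y : seq 'I_n) (i j : 'I_n) : bool :=
  (index i X < index j X) (+) (index (phi i) Y < index (phi j) Y).

Definition planar (t : tanglegram) : bool :=
  [exists X : n.-tuple 'I_n, exists Y : n.-tuple 'I_n,
    [&& leaf_order (fst_tree t) X, leaf_order (snd_tree t) Y
      & [forall i, forall j, ~~ crosses (matching t) X Y i j]]].

Definition leaf_matched (phi : {perm 'I_n}) (u v : btree 'I_n) : bool :=
  perm_eq [seq phi i | i <- leaves u] (leaves v).

Definition leaf_matched_pairs (t : tanglegram) :
    seq (btree 'I_n * btree 'I_n) :=
  [seq p <- [seq (u, v) | u <- internal_vertices (fst_tree t),
                          v <- internal_vertices (snd_tree t)]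
   | leaf_matched (matching t) p.1 p.2].

Definition irreducible (t : tanglegram) : bool :=
  (1 < n) && (leaf_matched_pairs t ==
              [:: (fst_tree t : btree 'I_n, snd_tree t : btree 'I_n)]).

End Sized.

Local Open Scope ring_scope.

(* A formal power series in x is its sequence of coefficients. *)
Definition fps (R : Type) : Type := nat -> R.

Section FPS.
Variable R : comNzRingType.
Implicit Types f g : fps R.

Definition fps_x : fps R := fun n => (n == 1%N)%:R.
Definition fps_one : fps R := fun n => (n == 0%N)%:R.
Definition fps_add f g : fps R := fun n => f n + g n.
Definition fps_mul f g : fps R := fun n => \sum_(i < n.+1) f i * g (n - i)%N.
Definition fps_scale (c : R) f : fps R := fun n => c * f n.
Definition fps_exp f (m : nat) : fps R := iter m (fps_mul f) fps_one.

(* The composite h(f), for f with zero constant term: f^m has no term of degree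
   less than m (fps_exp_eq0), so only m <= n contributes to the coefficient of
   x^n. *)
Definition fps_comp (h f : fps R) : fps R :=
  fun n => \sum_(m < n.+1) h m * fps_exp f m n.

Lemma fps_exp_eq0 f m n : f 0%N = 0 -> (n < m)%N ->
  fps_exp f m n = 0.
Proof.
move=> f0; elim: m n => // m IHm n ltnm; apply: big1 => -[[|i] lti] _.
  by rewrite f0 mul0r.
suff E : fps_exp f m (n - i.+1)%N = 0.
  by rewrite -(mulr0 (f i.+1)); congr (_ * _).
apply: IHm; rewrite (leq_ltn_trans (leq_sub2l n (ltn0Sn i))) // subn1.
by case: n lti ltnm => [|n] _ //; apply: ltnW.
Qed.

End FPS.

(* Series in x whose coefficients are polynomials in q, q being 'X. *)
Local Notation q := ('X : {poly rat}).

(* f(x^2, q^2) *)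
Definition fps_double (f : fps {poly rat}) : fps {poly rat} :=
  fun n => if odd n then 0 else f n./2 \Po 'X^2.

(* Planarity and the number of leaf-matched pairs are isomorphism invariants, so
   the choice of representatives is irrelevant. *)
Definition F : fps {poly rat} := fun n =>
  \sum_(c : tg_class n | planar (class_repr c))
    q ^+ size (leaf_matched_pairs (class_repr c)).

Definition H : fps {poly rat} := fun n =>
  if n == 2%N then (2%:R^-1 : rat)%:P
  else #|[set c : tg_class n | planar (class_repr c)
                          & irreducible (class_repr c)]|%:R.

Lemma F_0 : F 0%N = 0.
Proof.
apply: big1 => c _; have [T _ _] := class_repr c.
by have := size_leaves_gt0 T; rewrite (perm_size (ltreeP T)) size_enum_ord.
Qed.

(* Main.v *)
Require Import Defs.
From mathcomp Require Import all_boot all_order all_fingroup all_algebra.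
From mathcomp Require Import zify ring.

Set Implicit Arguments.
Unset Strict Implicit.
Unset Printing Implicit Defensive.

Import GRing.Theory.

(** A planar tanglegram with at least two leaves decomposes in a unique way.
    Its maximal proper leaf-matched pairs, completed by the matched leaves
    outside all of them, cut both trees into the same blocks of leaves.
    Contracting every block to a single leaf leaves an irreducible planar
    skeleton, and the parts of the two trees spanned by a block form a smaller planar
    tanglegram grafted on the corresponding leaf of the skeleton.  A leaf-matched
    pair of the whole is either the pair of roots or a leaf-matched pair of one
    of the grafted tanglegrams, so a skeleton with m leaves contributes
    q * F(x,q)^m, provided that different sequences of grafted tanglegrams give
    non-isomorphic results.

    This is the case when the skeleton has no automorphism but the identity,
    which holds as soon as it has three leaves (rigid).  Indeed a nontrivial
    automorphism f of a tree exchanges the two children a, b of some vertex v.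
    Let w be the lowest vertex of the other tree whose leaves contain those of
    v.  If f fixed both children c, d of w, then, as c and d both meet v, each
    of them would meet both a and b; this contradicts a crossing-free layout, in
    which a precedes b and c precedes d.  So f exchanges c and d.  Going back and
    forth between the two trees with larger and larger vertices yields a
    leaf-matched pair of vertices whose children are exchanged.  By
    irreducibility these are the two roots, and since exchanged children have
    equally many leaves, both trees split the layout in its middle: the first
    halves form a second leaf-matched pair unless they are single leaves.

    The only skeleton with two leaves has the exchange of its leaves as an
    automorphism.  It therefore contributes unordered pairs,
    q * (F(x,q)^2 + F(x^2,q^2)) / 2, which accounts for the coefficient 1/2 in H
    and for the last term of the equation.

    In the formal proof two matched leaves carry the same label, so that a
    tanglegram is a pair of trees on one set of labels, an isomorphism is a
    relabelling, and grafting is substitution at the leaves with labels in a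
    product type.  Existence of the decomposition is decompose, uniqueness is
    fill_tiso_inv, additivity of the number of leaf-matched pairs is
    num_matched_fill; F_codes turns them into an identity between sums, with one
    representative chosen in each isomorphism class. *)

(** * Leaves, vertices and relabelling of trees *)
Section Trees.
Variables (L L' : eqType).
Implicit Types (T U : btree L) (f : L -> L').

Fixpoint first_leaf T : L :=
  match T with Leaf a => a | Node l _ => first_leaf l end.

Lemma first_leaf_in T : first_leaf T \in leaves T.
Proof.
by elim: T => [a|l IHl r _] /=; rewrite ?mem_seq1 ?eqxx // mem_cat IHl.
Qed.

Lemma leaves_relabel (f : L -> L') T : leaves (relabel f T) = map f (leaves T).
Proof. by elim: T => //= l -> r ->; rewrite map_cat. Qed.

Lemma vertices_relabel (f : L -> L') T :
  vertices (relabel f T) = map (relabel f) (vertices T).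
Proof. by elim: T => //= l -> r ->; rewrite map_cat. Qed.

Lemma internal_relabel (f : L -> L') T :
  internal_vertices (relabel f T) = map (relabel f) (internal_vertices T).
Proof.
rewrite /internal_vertices vertices_relabel filter_map.
by congr map; apply: eq_filter; case.
Qed.

Lemma eq_in_relabel (f g : L -> L') T :
  {in leaves T, f =1 g} -> relabel f T = relabel g T.
Proof.
elim: T => [a|l IHl r IHr] /= fg; first by rewrite fg ?mem_seq1.
by rewrite IHl ?IHr // => x xi; apply: fg; rewrite mem_cat xi ?orbT.
Qed.

Lemma tree_sim_leaves T U : tree_sim T U -> perm_eq (leaves T) (leaves U).
Proof.
elim: T U => [a|l IHl r IHr] [b|l' r'] //=; first by move=> /eqP->.
case/orP=> /andP[/IHl h1 /IHr h2]; first exact: perm_cat.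
by rewrite perm_sym perm_catC perm_sym; apply: perm_cat.
Qed.

Lemma internal_Node (l r : btree L) : internal_vertices (Node l r) =
  Node l r :: internal_vertices l ++ internal_vertices r.
Proof. by rewrite /internal_vertices /= filter_cat. Qed.

Lemma internal_vertex T U :
  (U \in internal_vertices T) = is_internal U && (U \in vertices T).
Proof. by rewrite mem_filter. Qed.

Lemma vertices_root T : T \in vertices T.
Proof. by case: T => [a|l r] /=; rewrite ?mem_seq1 ?in_cons eqxx. Qed.

Lemma vertices_subseq T U : U \in vertices T -> subseq (leaves U) (leaves T).
Proof.
elim: T => [a|l IHl r IHr] /=.
  by rewrite mem_seq1 => /eqP-> /=; rewrite eqxx.
rewrite in_cons mem_cat => /or3P[/eqP-> //|/IHl s|/IHr s].
  exact: subseq_trans s (prefix_subseq _ _).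
exact: subseq_trans s (suffix_subseq _ _).
Qed.

Lemma vertices_sub T U : U \in vertices T -> {subset leaves U <= leaves T}.
Proof. by move/vertices_subseq/mem_subseq. Qed.

Lemma vertices_uniq T U :
  U \in vertices T -> uniq (leaves T) -> uniq (leaves U).
Proof. by move=> /vertices_subseq /subseq_uniq. Qed.

Lemma vertices_trans T U V :
  V \in vertices U -> U \in vertices T -> V \in vertices T.
Proof.
move=> VU; elim: T => [a|l IHl r IHr] /=.
  by rewrite mem_seq1 => /eqP E; move: VU; rewrite E /= mem_seq1.
rewrite in_cons mem_cat => /or3P[/eqP E|/IHl h|/IHr h].
- by rewrite -/(vertices (Node l r)) -E.
- by rewrite in_cons mem_cat h orbT.
- by rewrite in_cons mem_cat h !orbT.
Qed.

Lemma vertices_size_eq T U : U \in vertices T ->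
  size (leaves T) <= size (leaves U) -> U = T.
Proof.
case: T => [a|l r] /=; first by rewrite mem_seq1 => /eqP.
rewrite in_cons mem_cat => /or3P[/eqP-> //|/vertices_subseq|/vertices_subseq]
  /size_subseq; have := size_leaves_gt0 l; have := size_leaves_gt0 r;
  rewrite size_cat; lia.
Qed.

Lemma tree_sim_vertex T T' U : tree_sim T T' -> U \in vertices T ->
  exists2 U', U' \in vertices T' & tree_sim U U'.
Proof.
elim: T T' => [a|l IHl r IHr] [b|l' r'] //=.
  move=> ab; rewrite mem_seq1 => /eqP->; exists (Leaf b) => //.
  by rewrite mem_seq1.
move=> s; rewrite in_cons mem_cat => /or3P[/eqP->|Ul|Ur].
- by exists (Node l' r') => //; rewrite in_cons eqxx.
- case/orP: s => /andP[h1 h2].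
    by have [U' i ?] := IHl _ h1 Ul; exists U'; rewrite // in_cons mem_cat i orbT.
  by have [U' i ?] := IHl _ h1 Ul; exists U'; rewrite // in_cons mem_cat i !orbT.
- case/orP: s => /andP[h1 h2].
    by have [U' i ?] := IHr _ h2 Ur; exists U'; rewrite // in_cons mem_cat i !orbT.
  by have [U' i ?] := IHr _ h2 Ur; exists U'; rewrite // in_cons mem_cat i orbT.
Qed.

(** Two distinct vertices with the same leaves would be comparable with equal
    sizes, or lie in disjoint branches; neither is possible. *)
Lemma vertices_inj T U V : uniq (leaves T) ->
  U \in vertices T -> V \in vertices T -> leaves U = leaves V -> U = V.
Proof.
move=> uT UT VT E.
have : V \in vertices T by [].
elim: T uT UT VT => [a|l IHl r IHr] uT UT VT.
  by move: UT VT; rewrite /= !mem_seq1 => /eqP-> /eqP->.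
move: (UT) (VT); rewrite [in X in X -> _]/= [in X in _ -> X -> _]/=.
rewrite !in_cons !mem_cat.
have dis A B : A \in vertices l -> B \in vertices r -> leaves A = leaves B -> False.
  move=> Al Br EAB; move: uT; rewrite /= cat_uniq => /and3P[_ /hasPn h _].
  have i1 := first_leaf_in B.
  have := h _ (vertices_sub Br i1); rewrite -EAB in i1.
  by rewrite (vertices_sub Al i1).
have [ul ur] : uniq (leaves l) /\ uniq (leaves r).
  by move: uT; rewrite /= cat_uniq => /and3P[].
case/orP=> [/eqP EU|hU].
  by move=> _ _; rewrite EU in E *; apply/esym/(vertices_size_eq VT); rewrite E.
case/orP=> [/eqP EV|hV].
  by move=> _; rewrite EV in E *; apply/(vertices_size_eq UT); rewrite E.
case/orP: hU => hU; case/orP: hV => hV _.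
- exact: IHl.
- by case: (dis _ _ hU hV E).
- by case: (dis _ _ hV hU (esym E)).
- exact: IHr.
Qed.

(** The sets of leaves below the internal vertices form an isomorphism
    invariant of a tree, so any statistic of these sets has the same sum. *)
Lemma sum_internal_sim T T' (w : btree L -> nat) :
  (forall U V, perm_eq (leaves U) (leaves V) -> w U = w V) ->
  tree_sim T T' ->
  \sum_(u <- internal_vertices T) w u = \sum_(u <- internal_vertices T') w u.
Proof.
move=> wP; elim: T T' => [a|l IHl r IHr] [b|l' r'] //.
move=> s; rewrite !internal_Node !big_cons !big_cat /=.
rewrite (wP _ _ (tree_sim_leaves s)); congr addn.
by case/orP: s => /andP[/IHl-> /IHr->] //; rewrite addnC.
Qed.

End Trees.

(** * Tanglegrams as pairs of trees on a common set of labels *)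

(** Matched leaves have the same label: the matching is the identity of [L], and
    a leaf-matched pair is a pair of vertices with the same set of labels. *)
Definition tangle (L : Type) := (btree L * btree L)%type.

Definition relabel_tangle (L L' : Type) (f : L -> L') (A : tangle L) : tangle L' :=
  (relabel f A.1, relabel f A.2).

Section Tangle.
Variable L : eqType.
Implicit Types A B : tangle L.

Definition tgsize A := size (leaves A.1).
Definition valid A := uniq (leaves A.1) && perm_eq (leaves A.1) (leaves A.2).
(** A crossing-free layout: each tree is drawn with its leaves from left to
    right, and the two lists of labels agree. *)
Definition aligned A := uniq (leaves A.1) && (leaves A.1 == leaves A.2).
Definition tsim A B := tree_sim A.1 B.1 && tree_sim A.2 B.2.
Definition tplanar A := exists2 B, aligned B & tsim A B.
Definition num_matched A : nat :=
  \sum_(u <- internal_vertices A.1) \sum_(v <- internal_vertices A.2)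
     (perm_eq (leaves u) (leaves v) : nat).

Lemma tsim_refl A : tsim A A.
Proof. by rewrite /tsim !tree_sim_refl. Qed.
Lemma tsim_sym A B : tsim A B = tsim B A.
Proof. by rewrite /tsim tree_sim_sym [tree_sim B.2 _]tree_sim_sym. Qed.
Lemma tsim_trans B A C : tsim A B -> tsim B C -> tsim A C.
Proof.
move=> /andP[a1 a2] /andP[b1 b2].
by rewrite /tsim (tree_sim_trans a1 b1) (tree_sim_trans a2 b2).
Qed.

Lemma aligned_valid A : aligned A -> valid A.
Proof. by case/andP=> u /eqP e; rewrite /valid u e perm_refl. Qed.

Lemma tsim_size A B : tsim A B -> tgsize A = tgsize B.
Proof. by case/andP=> /tree_sim_leaves/perm_size. Qed.

Lemma tsim_valid A B : tsim A B -> valid A = valid B.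
Proof.
suff h A' B' : tsim A' B' -> valid A' -> valid B'.
  by move=> s; apply/idP/idP; apply: h; rewrite // tsim_sym.
case/andP=> /tree_sim_leaves h1 /tree_sim_leaves h2 /andP[u p].
rewrite /valid -(perm_uniq h1) u /=.
by rewrite -(permPl h1) -(permPr h2).
Qed.

Lemma tplanar_valid A : tplanar A -> valid A.
Proof. by case=> B /aligned_valid vB /tsim_valid ->. Qed.

Lemma tsim_num_matched A B : tsim A B -> num_matched A = num_matched B.
Proof.
case/andP=> s1 s2; rewrite /num_matched.
rewrite (sum_internal_sim _ s1); last first.
  move=> U V p; apply: eq_bigr => v _; by rewrite (permPl p).
apply: eq_bigr => u _; apply: sum_internal_sim s2.
by move=> U V p; rewrite (permPr p).
Qed.

(** Irreducibility by sizes rather than by a count of pairs; it is the form in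
    which the hypothesis is applied, see [num_matched_eq1]. *)
Definition tirreducible A := forall u v, u \in internal_vertices A.1 ->
  v \in internal_vertices A.2 -> perm_eq (leaves u) (leaves v) ->
  size (leaves u) = tgsize A.

(** The pair of roots contributes 1 to the count, and it is the only pair of
    vertices that has all the leaves below it. *)
Lemma num_matched_eq1 A : valid A -> 1 < tgsize A -> num_matched A = 1 <-> tirreducible A.
Proof.
case: A => [[a|l r] [b|l' r']] /andP[_ /= p] //; rewrite /tgsize //= => sz.
  by move/perm_size: p sz => /= ->.
have big (a b : btree L) (U : btree L) :
    U \in internal_vertices a ++ internal_vertices b ->
    size (leaves U) < size (leaves (Node a b)).
  rewrite /= size_cat mem_cat !internal_vertex.
  have := size_leaves_gt0 a; have := size_leaves_gt0 b.
  by move=> h1 h2 /orP[] /andP[_ /vertices_subseq/size_subseq]; lia.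
rewrite /num_matched /tirreducible /tgsize [fst _]/= [snd _]/= !internal_Node.
set R1 := _ ++ _; set R2 := _ ++ _.
rewrite !big_cons p.
split=> [[] h u v|h].
  rewrite in_cons => /orP[/eqP-> //|uR1] vR puv.
  have := h; rewrite [X in _ + X](big_rem u) //=.
  rewrite [X in _ + (X + _)](big_rem v) //= puv; lia.
rewrite big_seq big1 ?addn0 => [|v vR]; last first.
  case p' : perm_eq => //; have := big _ _ _ vR; rewrite -(perm_size p') /=.
  by rewrite (perm_size p) ltnn.
rewrite big_seq big1 // => u uR; rewrite big_seq big1 // => v vR.
case p' : perm_eq => //; have := big _ _ _ uR.
by rewrite (h u v) ?ltnn // in_cons uR orbT.
Qed.

End Tangle.

Section TIso.
Variables L L' : eqType.
Implicit Types (A : tangle L) (B : tangle L').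

Lemma relabel_size (f : L -> L') A : tgsize (relabel_tangle f A) = tgsize A.
Proof. by rewrite /tgsize leaves_relabel size_map. Qed.

Lemma relabel_valid (f : L -> L') A : {in leaves A.1 &, injective f} ->
  valid A -> valid (relabel_tangle f A).
Proof.
move=> fi /andP[u p]; rewrite /valid !leaves_relabel map_inj_in_uniq // u /=.
exact: perm_map.
Qed.

Lemma relabel_aligned (f : L -> L') A : {in leaves A.1 &, injective f} ->
  aligned A -> aligned (relabel_tangle f A).
Proof.
move=> fi /andP[u /eqP p].
by rewrite /aligned !leaves_relabel map_inj_in_uniq // u /= p.
Qed.

Lemma tsim_relabel (f : L -> L') A A' :
  tsim A A' -> tsim (relabel_tangle f A) (relabel_tangle f A').
Proof. by case/andP=> h1 h2; rewrite /tsim !tree_sim_relabel. Qed.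

(** [f] is inverted on [D], which stands for the labels in play. *)
Lemma perm_map_inj_in (f : L -> L') (D s t : seq L) : {in D &, injective f} ->
  {subset s <= D} -> {subset t <= D} ->
  perm_eq (map f s) (map f t) = perm_eq s t.
Proof.
move=> fi sD tD; apply/idP/idP; last exact: perm_map.
case: D fi sD tD => [|x0 D'].
  by move=> _; case: s => [|a s] sD; case: t => [|b t] tD //=;
    [have:=tD b| have:=sD a| have := sD a]; rewrite in_cons eqxx => /(_ isT).
set D := x0 :: D' => fi sD tD.
pose g y := nth x0 D (index y (map f D)).
have gK x : x \in D -> g (f x) = x.
  move=> xD; have fx : f x \in map f D by apply: map_f.
  apply: fi => //; first by rewrite mem_nth // -(size_map f) index_mem.
  by rewrite -(nth_map _ (f x0)) ?nth_index // -(size_map f) index_mem.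
move/(perm_map g); rewrite -!map_comp.
have e u : {subset u <= D} -> map (g \o f) u = u.
  by move=> uD; rewrite -[RHS]map_id; apply/eq_in_map => x /uD /gK.
by rewrite !e.
Qed.

Lemma relabel_num_matched (f : L -> L') A : {in leaves A.1 &, injective f} ->
  valid A -> num_matched (relabel_tangle f A) = num_matched A.
Proof.
move=> fi /andP[_ p]; rewrite /num_matched !internal_relabel big_map big_seq [RHS]big_seq.
apply: eq_bigr => u; rewrite internal_vertex => /andP[_ /vertices_sub ui].
rewrite big_map big_seq [RHS]big_seq; apply: eq_bigr => v.
rewrite internal_vertex => /andP[_ /vertices_sub vi].
rewrite !leaves_relabel (perm_map_inj_in (D := leaves A.1)) //.
by move=> x /vi; rewrite (perm_mem p).
Qed.

(** [f] need not be injective a priori: when [B] is valid, counting labels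
    forces injectivity on the leaves ([tiso_by_inj]). *)
Definition tiso_by (f : L -> L') A B := tsim (relabel_tangle f A) B.
Definition tiso A B := exists f, tiso_by f A B.

Lemma tiso_size A B : tiso A B -> tgsize A = tgsize B.
Proof. by case=> f /tsim_size <-; rewrite relabel_size. Qed.

Lemma tiso_by_perm f A B : tiso_by f A B -> perm_eq (map f (leaves A.1)) (leaves B.1).
Proof. by case/andP=> /tree_sim_leaves; rewrite leaves_relabel. Qed.

Lemma tiso_by_in f A B x : tiso_by f A B -> x \in leaves A.1 -> f x \in leaves B.1.
Proof. by move=> /tiso_by_perm/perm_mem <- xi; apply: map_f. Qed.

Lemma uniq_map_inj (f : L -> L') (s : seq L) : uniq (map f s) -> {in s &, injective f}.
Proof.
elim: s => //= a s IH /andP[na us] x y; rewrite !in_cons.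
case/orP=> [/eqP->|xs]; case/orP=> [/eqP->|ys] // E.
- by rewrite E map_f in na.
- by rewrite -E map_f in na.
- exact: IH.
Qed.

Lemma tiso_by_inj f A B : valid B -> tiso_by f A B -> {in leaves A.1 &, injective f}.
Proof.
case/andP=> u _ /tiso_by_perm/perm_uniq E; apply: uniq_map_inj; by rewrite E.
Qed.

Lemma tiso_num_matched A B : valid A -> valid B -> tiso A B -> num_matched A = num_matched B.
Proof.
move=> vA vB [f i]; rewrite -(tsim_num_matched i) relabel_num_matched //; exact: tiso_by_inj i.
Qed.

Lemma tiso_tplanar A B : valid B -> tiso A B -> tplanar A -> tplanar B.
Proof.
move=> vB [f i] [A' al s].
have s1 : perm_eq (leaves A.1) (leaves A'.1).
  by case/andP: s => /tree_sim_leaves.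
exists (relabel_tangle f A').
  apply: relabel_aligned => // x y; rewrite -!(perm_mem s1); exact: tiso_by_inj i _ _.
by apply: tsim_trans (tsim_relabel _ s); rewrite tsim_sym.
Qed.

Lemma relabel_tiso_by f A : tiso_by f A (relabel_tangle f A).
Proof. exact: tsim_refl. Qed.

End TIso.

Lemma relabel_tangle_comp (L L' L'' : Type) (f : L -> L') (g : L' -> L'') (A : tangle L) :
  relabel_tangle g (relabel_tangle f A) = relabel_tangle (g \o f) A.
Proof. by rewrite /relabel_tangle !relabel_comp. Qed.

Lemma eq_in_relabel_tangle (L L' : eqType) (f g : L -> L') (A : tangle L) :
  valid A -> {in leaves A.1, f =1 g} -> relabel_tangle f A = relabel_tangle g A.
Proof.
move=> /andP[_ p] fg; congr (_, _); apply: eq_in_relabel => // x xi; apply: fg.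
by rewrite (perm_mem p).
Qed.

Lemma relabel_tangle_id (L : Type) (A : tangle L) : relabel_tangle id A = A.
Proof. by case: A => T S; rewrite /relabel_tangle !relabel_id. Qed.

Lemma tiso_by_comp (L L' L'' : eqType) (f : L -> L') (g : L' -> L'') A B C :
  tiso_by f A B -> tiso_by g B C -> tiso_by (g \o f) A C.
Proof.
move=> /(tsim_relabel g) h1; rewrite relabel_tangle_comp in h1.
exact: tsim_trans h1.
Qed.

Lemma tiso_trans (L L' L'' : eqType) (A : tangle L) (B : tangle L') (C : tangle L'') :
  tiso A B -> tiso B C -> tiso A C.
Proof. by move=> [f h] [g k]; exists (g \o f); apply: tiso_by_comp h k. Qed.

Lemma tiso_by_inv (L L' : eqType) (f : L -> L') (A : tangle L) (B : tangle L') :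
  valid A -> valid B -> tiso_by f A B ->
  exists g, tiso_by g B A /\ {in leaves A.1, cancel f g}.
Proof.
move=> vA vB i; have fi := tiso_by_inj vB i.
set D := leaves A.1 in fi *; set x0 := first_leaf A.1.
pose g y := nth x0 D (index y (map f D)).
have gK : {in D, cancel f g}.
  move=> x xD; have fx : f x \in map f D by apply: map_f.
  apply: fi => //; first by rewrite mem_nth // -(size_map f) index_mem.
  by rewrite -(nth_map _ (f x0)) ?nth_index // -(size_map f) index_mem.
exists g; split=> //.
have := tsim_relabel g i; rewrite relabel_tangle_comp.
rewrite (@eq_in_relabel_tangle _ _ _ id) // relabel_tangle_id tsim_sym //.
Qed.

Lemma tiso_sym (L L' : eqType) (A : tangle L) (B : tangle L') :
  valid A -> valid B -> tiso A B -> tiso B A.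
Proof. by move=> vA vB [f /(tiso_by_inv vA vB) [g [h _]]]; exists g. Qed.

(** * Grafting tanglegrams on the leaves of a skeleton *)

(** A list induction replaces the axiom of choice. *)
Lemma seq_choice (A : eqType) (B : Type) (b0 : B) (R : A -> B -> Prop) (s : seq A) :
  (forall a, a \in s -> exists b, R a b) ->
  exists f, forall a, a \in s -> R a (f a).
Proof.
elim: s => [|a s IH] h; first by exists (fun=> b0).
have [f fP] : exists f, forall a, a \in s -> R a (f a).
  by apply: IH => x xs; apply: h; rewrite in_cons xs orbT.
have [b bP] := h a (mem_head _ _).
exists (fun x => if x == a then b else f x) => x.
by rewrite in_cons; case: eqP => [-> _|_ /= /fP].
Qed.

Section Graft.
Variables K L : eqType.
Implicit Types (T U : btree K) (c : K -> btree L).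

(** The pairing of labels keeps the leaves of distinct grafted trees distinct. *)
Fixpoint graft c T : btree (K * L) :=
  match T with
  | Leaf k => relabel (pair k) (c k)
  | Node l r => Node (graft c l) (graft c r)
  end.

Lemma leaves_graft c T :
  leaves (graft c T) = [seq (k, x) | k <- leaves T, x <- leaves (c k)].
Proof.
elim: T => [k|l IHl r IHr] /=; first by rewrite leaves_relabel /= cats0.
by rewrite IHl IHr allpairs_cat.
Qed.

Lemma mem_leaves_graft c T k x :
  ((k, x) \in leaves (graft c T)) = (k \in leaves T) && (x \in leaves (c k)).
Proof.
rewrite leaves_graft; apply/allpairsPdep/andP.
  by case=> k' [x' [h1 h2 [-> ->]]].
by case=> h1 h2; exists k, x.
Qed.

Lemma size_leaves_graft c T :
  size (leaves (graft c T)) = \sum_(k <- leaves T) size (leaves (c k)).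
Proof.
by elim: T => [k|l IHl r IHr] /=;
  rewrite ?leaves_relabel ?size_map ?big_seq1 // size_cat IHl IHr big_cat.
Qed.

Lemma sum_internal_graft c T (w : btree (K * L) -> nat) :
  \sum_(u <- internal_vertices (graft c T)) w u =
  \sum_(u <- internal_vertices T) w (graft c u) +
  \sum_(k <- leaves T) \sum_(u <- internal_vertices (c k)) w (relabel (pair k) u).
Proof.
elim: T => [k|l IHl r IHr] /=.
  by rewrite big_nil big_seq1 internal_relabel big_map.
rewrite !internal_Node !big_cons !big_cat /= IHl IHr; lia.
Qed.

(** A vertex of a grafted tree belongs either to the skeleton or to one of the
    grafted trees; the root of a grafted tree, which is also a leaf of the
    skeleton, is counted in the latter. *)
Lemma vertices_graft c T V : V \in vertices (graft c T) ->
  (exists2 u, u \in internal_vertices T & V = graft c u) \/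
  (exists2 k, k \in leaves T &
     exists2 u, u \in vertices (c k) & V = relabel (pair k) u).
Proof.
elim: T => [k|l IHl r IHr] /=.
  rewrite vertices_relabel => /mapP[u uc ->]; right.
  by exists k; rewrite ?mem_seq1 //; exists u.
rewrite in_cons mem_cat internal_Node => /or3P[/eqP->|/IHl|/IHr].
- by left; exists (Node l r); rewrite ?mem_head.
- case=> [[u ui ->]|[k kl h]]; [left|right].
    by exists u; rewrite // in_cons mem_cat ui orbT.
  by exists k; rewrite // mem_cat kl.
- case=> [[u ui ->]|[k kl h]]; [left|right].
    by exists u; rewrite // in_cons mem_cat ui !orbT.
  by exists k; rewrite // mem_cat kl orbT.
Qed.

Lemma graft_component c T k : k \in leaves T ->
  relabel (pair k) (c k) \in vertices (graft c T).
Proof.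
elim: T => [k'|l IHl r IHr] /=; first by rewrite mem_seq1 => /eqP->; exact: vertices_root.
by rewrite mem_cat in_cons mem_cat => /orP[/IHl->|/IHr->]; rewrite !orbT.
Qed.

Lemma internal_two_leaves T : is_internal T -> uniq (leaves T) ->
  exists k1 k2, [/\ k1 \in leaves T, k2 \in leaves T & k1 != k2].
Proof.
case: T => //= l r _; rewrite cat_uniq => /and3P[_ /hasPn h _].
exists (first_leaf l), (first_leaf r); rewrite !mem_cat !first_leaf_in orbT.
split=> //; apply/eqP => E; have := h _ (first_leaf_in r).
by rewrite -E /= first_leaf_in.
Qed.

(** An internal vertex of the skeleton is above two grafted trees, while a vertex
    of a grafted tree only has labels with one first component. *)
Lemma graft_neq_component c T k (V : btree L) : is_internal T -> uniq (leaves T) ->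
  perm_eq (leaves (graft c T)) (leaves (relabel (pair k) V)) = false.
Proof.
move=> i u; apply/negbTE/negP => p.
have [k1 [k2 [h1 h2 /eqP]]] := internal_two_leaves i u; apply.
have tag j : j \in leaves T -> j = k.
  move=> jT; have : (j, first_leaf (c j)) \in leaves (graft c T).
    by rewrite mem_leaves_graft jT first_leaf_in.
  by rewrite (perm_mem p) leaves_relabel => /mapP[x _ []].
by rewrite (tag _ h1) (tag _ h2).
Qed.

(** The skeleton labels below a vertex are the first components of the labels
    below it after grafting. *)
Lemma graft_clade_eq c c' T U : uniq (leaves T) -> uniq (leaves U) ->
  (forall k, k \in leaves T -> perm_eq (leaves (c k)) (leaves (c' k))) ->
  perm_eq (leaves (graft c T)) (leaves (graft c' U)) = perm_eq (leaves T) (leaves U).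
Proof.
move=> uT uU cc'; apply/idP/idP=> p; last first.
  rewrite !leaves_graft.
  apply: (@perm_trans _ [seq (k, x) | k <- leaves T, x <- leaves (c' k)]).
    exact: perm_allpairs_dep (perm_refl _) cc'.
  exact: perm_allpairs_dep p (fun _ _ => perm_refl _).
apply: uniq_perm => // k; apply/idP/idP => h.
  have : (k, first_leaf (c k)) \in leaves (graft c T).
    by rewrite mem_leaves_graft h first_leaf_in.
  by rewrite (perm_mem p) mem_leaves_graft => /andP[].
have : (k, first_leaf (c' k)) \in leaves (graft c' U).
  by rewrite mem_leaves_graft h first_leaf_in.
by rewrite -(perm_mem p) mem_leaves_graft => /andP[].
Qed.

End Graft.

Section GraftSim.
Variables K L K' L' : eqType.
Implicit Types (T : btree K).

Lemma graft_sim (s : K -> K') (h : K -> L -> L') (c : K -> btree L) c' T (T' : btree K') :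
  tree_sim (relabel s T) T' ->
  (forall k, k \in leaves T -> tree_sim (relabel (h k) (c k)) (c' (s k))) ->
  tree_sim (relabel (fun p => (s p.1, h p.1 p.2)) (graft c T)) (graft c' T').
Proof.
elim: T T' => [k|l IHl r IHr] [k'|l' r'] //=.
  move=> /eqP<- /(_ k (mem_head _ _)) /(tree_sim_relabel (pair (s k))).
  by rewrite !relabel_comp.
move=> ss cc.
have ccl k : k \in leaves l -> tree_sim (relabel (h k) (c k)) (c' (s k)).
  by move=> kl; apply: cc; rewrite mem_cat kl.
have ccr k : k \in leaves r -> tree_sim (relabel (h k) (c k)) (c' (s k)).
  by move=> kl; apply: cc; rewrite mem_cat kl orbT.
by case/orP: ss => /andP[h1 h2]; rewrite (IHl _ h1 ccl) (IHr _ h2 ccr) ?orbT.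
Qed.

(** Converse of [graft_sim], for an isomorphism [f] which maps every grafted tree
    into a single one: then [f] induces an isomorphism [s] of skeletons.  In the
    induction a leaf of one skeleton never faces an internal vertex of the other
    one, because [s] is well defined and injective on the labels of the
    skeleton. *)
Lemma graft_sim_inv (s : K -> K') (f : K * L -> K' * L') (c : K -> btree L) c' T (T' : btree K') :
  uniq (leaves T) -> uniq (leaves T') -> {in leaves T &, injective s} ->
  (forall k x, k \in leaves T -> x \in leaves (c k) -> (f (k, x)).1 = s k) ->
  tree_sim (relabel f (graft c T)) (graft c' T') ->
  tree_sim (relabel s T) T' /\
  forall k, k \in leaves T ->
    tree_sim (relabel (fun x => (f (k, x)).2) (c k)) (c' (s k)).
Proof.
elim: T T' => [k|l IHl r IHr] [k'|l' r'] uT uT' si sf ts.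
- have e : s k = k'.
    have := tree_sim_leaves ts; rewrite /= relabel_comp !leaves_relabel => p.
    have : f (k, first_leaf (c k)) \in map (pair k') (leaves (c' k')).
      rewrite -(perm_mem p); apply/mapP; exists (first_leaf (c k)) => //.
      exact: first_leaf_in.
    case/mapP => x _ /(congr1 fst) /=.
    by rewrite sf ?mem_head ?first_leaf_in.
  split=> [|j]; first by rewrite /= e.
  rewrite mem_seq1 => /eqP->; have := tree_sim_relabel snd ts.
  by rewrite /= !relabel_comp e (eq_relabel (g := id)) // relabel_id.
- have := internal_two_leaves (T := Node l' r') isT uT'.
  case=> k1 [k2 [h1 h2 /eqP]]; case.
  have tag j : j \in leaves (Node l' r') -> j = s k.
    move=> jT; have : (j, first_leaf (c' j)) \in leaves (graft c' (Node l' r')).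
      by rewrite mem_leaves_graft jT first_leaf_in.
    rewrite -(perm_mem (tree_sim_leaves ts)) /= relabel_comp leaves_relabel.
    by case/mapP=> x xi /(congr1 fst) /= ->; rewrite sf ?mem_head.
  by rewrite (tag _ h1) (tag _ h2).
- have := internal_two_leaves (T := Node l r) isT uT.
  case=> k1 [k2 [h1 h2 /eqP]]; case; apply: si => //.
  have tag j : j \in leaves (Node l r) -> s j = k'.
    move=> jT; rewrite -(sf _ (first_leaf (c j))) ?first_leaf_in //.
    have : f (j, first_leaf (c j)) \in map f (leaves (graft c (Node l r))).
      by apply: map_f; rewrite mem_leaves_graft jT first_leaf_in.
    rewrite -leaves_relabel (perm_mem (tree_sim_leaves ts)) /= leaves_relabel.
    by case/mapP=> x _ ->.
  by rewrite !tag.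
- have [[ul ur] [ul' ur']] : (uniq (leaves l) /\ uniq (leaves r)) /\
      (uniq (leaves l') /\ uniq (leaves r')).
    by move: uT uT'; rewrite /= !cat_uniq => /and3P[-> _ ->] /and3P[-> _ ->].
  have [sl sr] : {in leaves l &, injective s} /\ {in leaves r &, injective s}.
    by split=> x y xi yi; apply: si; rewrite /= mem_cat ?xi ?yi ?orbT.
  have fl k x : k \in leaves l -> x \in leaves (c k) -> (f (k, x)).1 = s k.
    by move=> kl; apply: sf; rewrite /= mem_cat kl.
  have fr k x : k \in leaves r -> x \in leaves (c k) -> (f (k, x)).1 = s k.
    by move=> kl; apply: sf; rewrite /= mem_cat kl orbT.
  case/orP: ts => /andP[h1 h2].
    have [a1 a2] := IHl _ ul ul' sl fl h1; have [b1 b2] := IHr _ ur ur' sr fr h2.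
    split; first by rewrite /= a1 b1.
    by move=> k; rewrite /= mem_cat => /orP[/a2|/b2].
  have [a1 a2] := IHl _ ul ur' sl fl h1; have [b1 b2] := IHr _ ur ul' sr fr h2.
  split; first by rewrite /= a1 b1 orbT.
  by move=> k; rewrite /= mem_cat => /orP[/a2|/b2].
Qed.

End GraftSim.

Section Fill.
Variables K L : eqType.
Implicit Types (A : tangle K) (g : K -> tangle L).

Definition fill A g : tangle (K * L) :=
  (graft (fun k => (g k).1) A.1, graft (fun k => (g k).2) A.2).

Lemma tgsize_fill A g : tgsize (fill A g) = \sum_(k <- leaves A.1) tgsize (g k).
Proof. exact: size_leaves_graft. Qed.

Lemma uniq_graft (c : K -> btree L) (T : btree K) : uniq (leaves T) ->
  {in leaves T, forall k, uniq (leaves (c k))} -> uniq (leaves (graft c T)).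
Proof.
move=> uT uc; rewrite leaves_graft; apply: allpairs_uniq_dep => //.
by move=> [k x] [k' x'] _ _ /= [-> ->].
Qed.

Lemma fill_valid A g : valid A -> {in leaves A.1, forall k, valid (g k)} ->
  valid (fill A g).
Proof.
move=> /andP[u p] vg; rewrite /valid uniq_graft //=; last by move=> k /vg /andP[].
rewrite graft_clade_eq // -?(perm_uniq p) // => k /vg /andP[] //.
Qed.

Lemma fill_aligned A g : aligned A -> {in leaves A.1, forall k, aligned (g k)} ->
  aligned (fill A g).
Proof.
move=> /andP[u /eqP p] vg; rewrite /aligned uniq_graft //=; last by move=> k /vg /andP[].
rewrite !leaves_graft -p; apply/eqP; congr flatten; apply/eq_in_map => k /vg.
by case/andP=> _ /eqP->.
Qed.

(** Pairs made of one vertex of the skeleton and one vertex of a grafted tree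
    never match, nor do vertices of grafted trees at different leaves. *)
Lemma num_matched_fill A g : valid A -> {in leaves A.1, forall k, valid (g k)} ->
  num_matched (fill A g) = num_matched A + \sum_(k <- leaves A.1) num_matched (g k).
Proof.
move=> /andP[u p] vg; have u2 : uniq (leaves A.2) by rewrite -(perm_uniq p).
rewrite {1}/num_matched sum_internal_graft; congr addn.
  rewrite /num_matched big_seq [RHS]big_seq; apply: eq_bigr => U.
  rewrite internal_vertex => /andP[Ui Uv]; rewrite sum_internal_graft.
  rewrite [X in _ + X]big1 ?addn0; last first.
    move=> k _; rewrite big1 // => V _; rewrite graft_neq_component //.
    exact: vertices_uniq Uv u.
  rewrite big_seq [RHS]big_seq; apply: eq_bigr => V.
  rewrite internal_vertex => /andP[Vi Vv].
  rewrite graft_clade_eq ?(vertices_uniq Uv) ?(vertices_uniq Vv) //.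
  by move=> k /(vertices_sub Uv) /vg /andP[].
rewrite big_seq [RHS]big_seq; apply: eq_bigr => k kA.
apply: eq_bigr => U _; rewrite sum_internal_graft.
rewrite [X in X + _]big_seq [X in X + _]big1 ?add0n; last first.
  move=> V; rewrite internal_vertex => /andP[Vi Vv].
  by rewrite perm_sym graft_neq_component // (vertices_uniq Vv).
rewrite (bigD1_seq k) ?u2 -?(perm_mem p) //= [X in _ + X]big1 ?addn0.
  apply: eq_bigr => V _; rewrite !leaves_relabel.
  by rewrite (@perm_map_inj_in _ _ (pair k) (leaves U ++ leaves V)) //;
     [move=> x y _ _ []|move=> x xi; rewrite mem_cat xi ?orbT ..].
move=> k' /eqP kk'; rewrite big1 // => V _.
rewrite !leaves_relabel; case p' : perm_eq => //; case: kk'.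
have := perm_mem p' (k, first_leaf U); rewrite map_f ?first_leaf_in //.
by case/esym/mapP=> x _ [].
Qed.

End Fill.

Section FillIso.
Variables K L K' L' : eqType.

Lemma fill_tiso_by (s : K -> K') (h : K -> L -> L') (A : tangle K) (A' : tangle K')
    (g : K -> tangle L) (g' : K' -> tangle L') :
  valid A -> tiso_by s A A' ->
  (forall k, k \in leaves A.1 -> tiso_by (h k) (g k) (g' (s k))) ->
  tiso_by (fun p => (s p.1, h p.1 p.2)) (fill A g) (fill A' g').
Proof.
move=> /andP[_ p] /andP[s1 s2] gg; apply/andP; split.
  by apply: graft_sim s1 _ => k /gg /andP[].
by apply: graft_sim s2 _ => k; rewrite -(perm_mem p) => /gg /andP[].
Qed.

Lemma fill_tiso (s : K -> K') (A : tangle K) (A' : tangle K')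
    (g : K -> tangle L) (g' : K' -> tangle L') :
  valid A -> tiso_by s A A' ->
  (forall k, k \in leaves A.1 -> tiso (g k) (g' (s k))) ->
  tiso (fill A g) (fill A' g').
Proof.
move=> vA i gg.
have [h hP] := @seq_choice _ _ (fun=> first_leaf (g' (s (first_leaf A.1))).1)
  (fun k h => tiso_by h (g k) (g' (s k))) _ gg.
by exists (fun p => (s p.1, h p.1 p.2)); apply: fill_tiso_by.
Qed.

End FillIso.

Lemma fill_tplanar (K L : eqType) (A : tangle K) (g : K -> tangle L) :
  tplanar A -> {in leaves A.1, forall k, tplanar (g k)} -> tplanar (fill A g).
Proof.
move=> pA pg; have vA := tplanar_valid pA; case: pA => A' al sA.
have [g' g'P] := @seq_choice _ _ (g (first_leaf A.1))
   (fun k B => aligned B /\ tsim (g k) B) _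
   (fun k ki => let: ex_intro2 B a b := pg k ki in ex_intro _ B (conj a b)).
have vf : valid (fill A g) by apply: fill_valid => // k /pg /tplanar_valid.
have pl : perm_eq (leaves A'.1) (leaves A.1).
  by rewrite perm_sym; case/andP: sA => /tree_sim_leaves.
apply: (@tiso_tplanar _ _ (fill A' g')) => //.
  apply: (@fill_tiso _ _ _ _ id) => [||k].
  - exact: aligned_valid.
  - by rewrite /tiso_by relabel_tangle_id tsim_sym.
  rewrite (perm_mem pl) => /g'P[_ s]; exists id.
  by rewrite /tiso_by relabel_tangle_id tsim_sym.
exists (fill A' g'); last exact: tsim_refl.
by apply: fill_aligned => // k; rewrite (perm_mem pl) => /g'P[].
Qed.

(** * An isomorphism of composites preserves the decomposition *)
Section Linked.
Variable L : eqType.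

(** Lying below a common proper leaf-matched pair.  Single leaves are allowed as
    vertices here, so that every label is linked to itself.  The relation is
    invariant under isomorphism by construction, and in a composite with
    irreducible skeleton its classes are the blocks. *)
Definition linked (A : tangle L) (x y : L) :=
  exists u v, [/\ u \in vertices A.1, v \in vertices A.2,
    perm_eq (leaves u) (leaves v), (x \in leaves u) && (y \in leaves u)
    & size (leaves u) < tgsize A].

End Linked.

Lemma linked_iso (L L' : eqType) (f : L -> L') (A : tangle L) (B : tangle L') x y :
  tiso_by f A B -> linked A x y -> linked B (f x) (f y).
Proof.
move=> i [u [v [uA vA p xy sz]]]; have szE := tiso_size (ex_intro _ f i).
case/andP: i => s1 s2.
have [u' u'B su] : exists2 u', u' \in vertices B.1 & tree_sim (relabel f u) u'.
  by apply: tree_sim_vertex s1 _; rewrite vertices_relabel map_f.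
have [v' v'B sv] : exists2 v', v' \in vertices B.2 & tree_sim (relabel f v) v'.
  by apply: tree_sim_vertex s2 _; rewrite vertices_relabel map_f.
have pu := tree_sim_leaves su; have pv := tree_sim_leaves sv.
rewrite !leaves_relabel in pu pv.
exists u', v'; split=> //.
- by rewrite -(permPl pu) -(permPr pv) perm_map.
- by rewrite -!(perm_mem pu) !map_f //; case/andP: xy.
- by rewrite -(perm_size pu) size_map -szE.
Qed.

(** A matched pair of skeleton vertices has all the leaves below it, by
    irreducibility; hence a proper one lies inside a grafted tanglegram. *)
Lemma linked_fill (K L : eqType) (A : tangle K) (g : K -> tangle L) x y :
  valid A -> tirreducible A -> 1 < tgsize A -> {in leaves A.1, forall k, valid (g k)} ->
  x \in leaves (fill A g).1 -> y \in leaves (fill A g).1 ->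
  linked (fill A g) x y <-> x.1 = y.1.
Proof.
case: x y => [k x] [k' y] /andP[u p] iA sA vg.
rewrite !mem_leaves_graft => /andP[kA xg] /andP[kA' yg] /=; split.
  have u2 : uniq (leaves A.2) by rewrite -(perm_uniq p).
  case=> U [V [UA VA pUV /andP[xU yU] sz]].
  case: (vertices_graft UA) => [[U0]|[j _ [U0 _ EU]]]; last first.
    by move: xU yU; rewrite EU leaves_relabel => /mapP[? _ [-> _]] /mapP[? _ []].
  rewrite internal_vertex => /andP[U0i U0A] EU.
  case: (vertices_graft VA) => [[V0]|[j _ [V0 _ EV]]]; last first.
    move: xU yU; rewrite !(perm_mem pUV) EV leaves_relabel.
    by move=> /mapP[? _ [-> _]] /mapP[? _ []].
  rewrite internal_vertex => /andP[V0i V0A] EV.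
  move: pUV; rewrite EU EV graft_clade_eq ?(vertices_uniq U0A) ?(vertices_uniq V0A) //.
    move=> /(iA _ _) h; have {}h : size (leaves U0) = tgsize A.
      by apply: h; rewrite internal_vertex ?U0i ?V0i.
    have e : U0 = A.1 by apply: vertices_size_eq => //; rewrite h.
    by move: sz; rewrite EU e ltnn.
  by move=> j /(vertices_sub U0A) /vg /andP[].
move=> e; rewrite -{}e {k' kA'} in yg *.
exists (relabel (pair k) (g k).1), (relabel (pair k) (g k).2).
split; rewrite ?graft_component -?(perm_mem p) //.
- by rewrite !leaves_relabel perm_map //; have /andP[] := vg _ kA.
- by rewrite !leaves_relabel !map_f.
rewrite tgsize_fill leaves_relabel size_map (bigD1_seq k) //= -addn1 leq_add2l.
move: u sA; rewrite /tgsize; move: kA; case: (A.1) => [a|l r] // kA u _.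
have [k1 [k2 [h1 h2 h12]]] := internal_two_leaves (T := Node l r) isT u.
have [j jA jk] : exists2 j, j \in leaves (Node l r) & j != k.
  by case: (eqVneq k1 k) => [e|]; [exists k2; rewrite // -e eq_sym | exists k1].
by rewrite (big_rem j) //= jk addn_gt0 size_leaves_gt0.
Qed.

(** The isomorphism preserves the classes of [linked], that is the blocks, in both
    directions; so it permutes the grafted tanglegrams and [graft_sim_inv]
    applies to both trees. *)
Lemma fill_tiso_inv (K L K' L' : eqType) (A : tangle K) (A' : tangle K')
    (g : K -> tangle L) (g' : K' -> tangle L') :
  valid A -> tirreducible A -> 1 < tgsize A -> {in leaves A.1, forall k, valid (g k)} ->
  valid A' -> tirreducible A' -> 1 < tgsize A' -> {in leaves A'.1, forall k, valid (g' k)} ->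
  tiso (fill A g) (fill A' g') ->
  exists2 s, tiso_by s A A' & forall k, k \in leaves A.1 -> tiso (g k) (g' (s k)).
Proof.
move=> vA iA sA vg vA' iA' sA' vg' [f i].
have vF := fill_valid vA vg; have vF' := fill_valid vA' vg'.
have [f' [i' fK]] := tiso_by_inv vF vF' i.
pose s k := (f (k, first_leaf (g k).1)).1.
have inF k x : k \in leaves A.1 -> x \in leaves (g k).1 -> (k, x) \in leaves (fill A g).1.
  by move=> h1 h2; rewrite mem_leaves_graft h1.
have sf k x : k \in leaves A.1 -> x \in leaves (g k).1 -> (f (k, x)).1 = s k.
  move=> kA xg; apply/(linked_fill vA' iA' sA' vg').
  - exact: tiso_by_in i (inF _ _ kA xg).
  - apply: tiso_by_in i (inF _ _ kA _); exact: first_leaf_in.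
  - apply: linked_iso i _; apply/linked_fill => //; apply: inF => //.
    exact: first_leaf_in.
have si : {in leaves A.1 &, injective s}.
  move=> k k' kA kA' E.
  have h1 : (k, first_leaf (g k).1) \in leaves (fill A g).1 by rewrite inF ?first_leaf_in.
  have h2 : (k', first_leaf (g k').1) \in leaves (fill A g).1 by rewrite inF ?first_leaf_in.
  have : linked (fill A' g') (f (k, first_leaf (g k).1)) (f (k', first_leaf (g k').1)).
    by apply/linked_fill => //; apply: tiso_by_in i _.
  move/(linked_iso i'); rewrite !fK // => /linked_fill; exact.
case/andP: (vA) => u1 p; case/andP: (vA') => u1' p'.
case/andP: i => s1 s2.
have [a1 a2] := graft_sim_inv u1 u1' si sf s1.
have [||||b1 b2] := @graft_sim_inv _ _ _ _ s f _ _ _ _ _ _ _ _ s2.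
- by rewrite -(perm_uniq p).
- by rewrite -(perm_uniq p').
- by move=> x y; rewrite -!(perm_mem p); apply: si.
- move=> k x; rewrite -(perm_mem p) => kA; have /andP[_ q] := vg _ kA.
  by rewrite -(perm_mem q); apply: sf.
exists s; first by rewrite /tiso_by /tsim /= a1 b1.
move=> k kA; exists (fun x => (f (k, x)).2); apply/andP; split; first exact: a2.
by apply: b2; rewrite -(perm_mem p).
Qed.

(** * Irreducible planar tanglegrams with at least three leaves are rigid *)
Section Rigid.
Variable L : eqType.
Implicit Types (T S : btree L) (f : L -> L).

Lemma vertices_order T a b x y : uniq (leaves T) -> Node a b \in vertices T ->
  x \in leaves a -> y \in leaves b ->
  index x (leaves T) < index y (leaves T).
Proof.
elim: T => [k|l IHl r IHr] uT; first by rewrite /= mem_seq1.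
rewrite in_cons mem_cat => vT xa yb; move: uT vT.
rewrite /= cat_uniq => /and3P[ul /hasPn dis ur].
rewrite !index_cat => /or3P[/eqP[el er]|h|h].
- rewrite -el -er xa; have /dis /= : y \in leaves r by rewrite -er.
  rewrite -el => /negbTE->; rewrite ltn_addr // index_mem //.
- have s := vertices_sub h.
  by rewrite !s ?(IHl ul h xa yb) //= mem_cat ?xa ?yb ?orbT.
- have s := vertices_sub h.
  have xr : x \in leaves r by apply: s; rewrite /= mem_cat xa.
  have yr : y \in leaves r by apply: s; rewrite /= mem_cat yb orbT.
  have /negbTE /= -> := dis _ xr; have /negbTE /= -> := dis _ yr.
  by rewrite ltn_add2l (IHr ur h xa yb).
Qed.

Definition swapped f T a b := [/\ Node a b \in vertices T,
  tree_sim (relabel f a) b & tree_sim (relabel f b) a].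

Lemma sim_mem f a b x : tree_sim (relabel f a) b -> x \in leaves a -> f x \in leaves b.
Proof.
by move/tree_sim_leaves/perm_mem => <- xa; rewrite leaves_relabel map_f.
Qed.

Lemma swapped_stable f T a b : swapped f T a b ->
  forall x, x \in leaves (Node a b) -> f x \in leaves (Node a b).
Proof.
by case=> _ s1 s2 x /=; rewrite !mem_cat => /orP[/(sim_mem s1)->|/(sim_mem s2)->];
   rewrite ?orbT.
Qed.

Lemma aut_swapped f T : tree_sim (relabel f T) T ->
  {in leaves T, f =1 id} \/ exists a b, swapped f T a b.
Proof.
elim: T => [k|l IHl r IHr].
  by move=> /= /eqP fk; left=> x; rewrite mem_seq1 => /eqP->.
case/orP=> /andP[h1 h2]; last first.
  by right; exists l, r; split=> //; apply: vertices_root.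
case: (IHl h1) => [fl|[a [b [h s1 s2]]]]; last first.
  by right; exists a, b; split; rewrite // in_cons mem_cat h orbT.
case: (IHr h2) => [fr|[a [b [h s1 s2]]]]; last first.
  by right; exists a, b; split; rewrite // in_cons mem_cat h !orbT.
by left=> x; rewrite /= mem_cat => /orP[/fl|/fr].
Qed.

(** The lowest vertex [w] of [S] whose leaves contain [I].  The descent from the
    root stays in the fixed branches, since a branch exchanged with its sibling
    cannot contain the [f]-stable set [I]. *)
Lemma hull f S (I : seq L) x0 : uniq (leaves S) -> tree_sim (relabel f S) S ->
  x0 \in I -> (forall x, x \in I -> f x \in I) -> {subset I <= leaves S} ->
  exists w, [/\ w \in vertices S, {subset I <= leaves w}, tree_sim (relabel f w) w
    & (exists a, w = Leaf a) \/
      (exists w1 w2, [/\ w = Node w1 w2, exists2 x, x \in I & x \in leaves w1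
                       & exists2 x, x \in I & x \in leaves w2])].
Proof.
move=> uS sS x0I fI; elim: S uS sS => [k|l IHl r IHr] uS sS IS.
  exists (Leaf k); split=> //; first exact: vertices_root.
  by left; exists k.
move: (uS); rewrite /= cat_uniq => /and3P[ul /hasPn dis ur].
have [lI|/allPn[x xI /= xl]] := boolP (all (mem (leaves l)) I).
  have {}lI : {subset I <= leaves l} by move=> x /(allP lI).
  case: (IHl ul) => // [|w [wl Iw sw h]].
    case/orP: sS => /andP[h1 h2] //.
    by have /= := dis _ (sim_mem h1 (lI _ x0I)); rewrite lI // fI.
  by exists w; split=> //; rewrite in_cons mem_cat wl orbT.
have [rI|/allPn[y yI /= yr]] := boolP (all (mem (leaves r)) I).
  have {}rI : {subset I <= leaves r} by move=> z /(allP rI).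
  case: (IHr ur) => // [|w [wl Iw sw h]].
    case/orP: sS => /andP[h1 h2] //.
    by have /= := dis _ (rI _ (fI _ x0I)); rewrite (sim_mem h2) ?rI.
  by exists w; split=> //; rewrite in_cons mem_cat wl !orbT.
exists (Node l r); split=> //; first exact: vertices_root.
right; exists l, r; split=> //.
  by exists y => //; move: (IS _ yI); rewrite /= mem_cat (negbTE yr) orbF.
by exists x => //; move: (IS _ xI); rewrite /= mem_cat (negbTE xl).
Qed.

(** Crossing-free layouts make the hull of a swapped vertex swapped as well. *)
Lemma swapped_hull f T S a b : uniq (leaves T) -> leaves T = leaves S ->
  tree_sim (relabel f S) S -> swapped f T a b ->
  exists c d, swapped f S c d /\ {subset leaves (Node a b) <= leaves (Node c d)}.
Proof.
move=> uT ST sS sw; have stab := swapped_stable sw.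
have uS : uniq (leaves S) by rewrite -ST.
case: sw => vT s1 s2.
have IS : {subset leaves (Node a b) <= leaves S}.
  by rewrite -ST; apply: vertices_sub.
have [w [wS Iw sw]] := hull uS sS (first_leaf_in (Node a b)) stab IS.
have uv := vertices_uniq vT uT.
case=> [[k wk]|[c [d [wE [x xI xc] [y yI yd]]]]].
  have [k1 [k2 [/Iw h1 /Iw h2 /eqP]]] := internal_two_leaves (T := Node a b) isT uv.
  by case; move: h1 h2; rewrite wk /= !mem_seq1 => /eqP-> /eqP->.
exists c, d; rewrite -wE; split=> //; rewrite wE in wS sw.
case/orP: sw => /andP[h1 h2]; last by split.
(* Here c and d are f-stable.  Each of them meets both a and b, as f exchanges
   the latter; so c contains a leaf x' of b, and d a leaf y' of a, which have to
   be in both orders. *)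
have [x' x'b x'c] : exists2 z, z \in leaves b & z \in leaves c.
  move: xI; rewrite /= mem_cat => /orP[xa|xb]; last by exists x.
  by exists (f x); [exact: sim_mem s1 xa|exact: sim_mem h1 xc].
have [y' y'a y'd] : exists2 z, z \in leaves a & z \in leaves d.
  move: yI; rewrite /= mem_cat => /orP[ya|yb]; first by exists y.
  by exists (f y); [exact: sim_mem s2 yb|exact: sim_mem h2 yd].
have := vertices_order uT vT y'a x'b; have := vertices_order uS wS x'c y'd.
by rewrite -ST => /ltnW; rewrite leqNgt => /negP.
Qed.

(** Alternating hulls in [S] and in [T] gives larger and larger swapped vertices;
    when the size stops growing, the last two vertices match. *)
Lemma swapped_pair f T S a b : uniq (leaves T) -> leaves T = leaves S ->
  tree_sim (relabel f T) T -> tree_sim (relabel f S) S -> swapped f T a b ->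
  exists a' b' c d, [/\ swapped f T a' b', swapped f S c d
     & perm_eq (leaves (Node a' b')) (leaves (Node c d))].
Proof.
move=> uT ST sT sS; have uS : uniq (leaves S) by rewrite -ST.
have [m] := ubnP (size (leaves T) - size (leaves (Node a b))).
elim: m a b => // m IH a b ltm sw.
have [c [d [sw1 sub1]]] := swapped_hull uT ST sS sw.
have [a' [b' [sw2 sub2]]] := swapped_hull uS (esym ST) sT sw1.
have [uab ucd] : uniq (leaves (Node a b)) /\ uniq (leaves (Node c d)).
  case: sw sw1 => v1 _ _ [v2 _ _].
  by rewrite (vertices_uniq v1 uT) (vertices_uniq v2 uS).
have le1 := uniq_leq_size uab sub1; have le2 := uniq_leq_size ucd sub2.
have [le3|lt3] := leqP (size (leaves (Node c d))) (size (leaves (Node a b))).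
  exists a, b, c, d; split=> //; apply: uniq_perm => //.
  by have [] := uniq_min_size uab sub1 le3.
apply: (IH a' b') => //; have : size (leaves (Node a' b')) <= size (leaves T).
  by case: sw2 => /vertices_subseq/size_subseq.
move: ltm le1 le2 lt3; set p := size _; set q := size (leaves (Node a' b')).
set r := size (leaves (Node c d)); set s := size (leaves (Node a b)); lia.
Qed.

Lemma swapped_size f T a b : swapped f T a b -> size (leaves a) = size (leaves b).
Proof. by case=> _ /tree_sim_leaves/perm_size; rewrite leaves_relabel size_map. Qed.

(** The matched swapped vertices are the roots by irreducibility.  Their left
    children then have the first half of the layout as leaves, and would be a
    second leaf-matched pair. *)
Lemma rigid_aligned f (A : tangle L) : aligned A -> tirreducible A -> 2 < tgsize A ->
  tiso_by f A A -> {in leaves A.1, f =1 id}.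
Proof.
case: A => T S /andP[/= uT /eqP ST] iA sz /andP[/= sT sS].
case: (aut_swapped sT) => // -[a0 [b0 /(swapped_pair uT ST sT sS)]].
case=> a [b [c [d [sw1 sw2 p]]]]; exfalso.
have szab := swapped_size sw1; have szcd := swapped_size sw2.
case: sw1 sw2 => v1 _ _ [v2 _ _].
have szT : size (leaves (Node a b)) = size (leaves T).
  by apply: (iA _ (Node c d)) => //; rewrite internal_vertex.
have eT : Node a b = T by apply: vertices_size_eq; rewrite ?szT.
have eS : Node c d = S.
  by apply: vertices_size_eq => //; rewrite -(perm_size p) szT ST.
have eac : leaves a = leaves c.
  move: ST; rewrite -eT -eS /= => /eqP; rewrite eqseq_cat; first by case/andP=> /eqP.
  have := perm_size p; rewrite /= !size_cat szab szcd; lia.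
move: sz; rewrite /tgsize /= -szT /= size_cat -szab => sz.
have ia : is_internal a by case: (a) sz.
have ic : is_internal c by move: sz; rewrite eac; case: (c).
have : size (leaves a) = size (leaves T).
  apply: (iA _ c); rewrite ?internal_vertex ?ia ?ic //= ?eac //.
    apply: vertices_trans v1; by rewrite /= in_cons mem_cat vertices_root orbT.
  apply: vertices_trans v2; by rewrite /= in_cons mem_cat vertices_root orbT.
by rewrite -szT /= size_cat -szab; move: sz; lia.
Qed.

End Rigid.

Lemma tiso_irreducible (K L : eqType) (A : tangle K) (B : tangle L) :
  valid A -> valid B -> tiso A B -> 1 < tgsize A -> tirreducible A -> tirreducible B.
Proof.
move=> vA vB i sz iA; apply/num_matched_eq1 => //; first by rewrite -(tiso_size i).
by rewrite -(tiso_num_matched vA vB i); apply/num_matched_eq1.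
Qed.

Lemma rigid (L : eqType) f (A : tangle L) : tplanar A -> tirreducible A -> 2 < tgsize A ->
  tiso_by f A A -> {in leaves A.1, f =1 id}.
Proof.
move=> pA; have vA := tplanar_valid pA; case: pA => B al s iA sz i.
have sB : tiso_by id A B by rewrite /tiso_by relabel_tangle_id.
have iB : tirreducible B.
  apply: (tiso_irreducible vA (aligned_valid al)) => //; [by exists id|exact: ltnW].
have e : perm_eq (leaves A.1) (leaves B.1) by case/andP: s => /tree_sim_leaves.
have := @rigid_aligned _ f B al iB; rewrite -(tsim_size s) => /(_ sz) h x.
rewrite (perm_mem e); apply: h.
have s2 : tsim B A by rewrite tsim_sym.
exact: tsim_trans (tsim_trans (tsim_relabel f s2) i) s.
Qed.

(** * Existence of the decomposition *)
Section Cut.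
Variable L : eqType.
Implicit Types (T S U : btree L) (E : seq (seq L)).

(** The tree [T] truncated at its highest vertices whose list of leaves is in [E];
    such a list becomes the label of the new leaf.  With aligned trees the labels
    can be lists instead of sets. *)
Fixpoint cut E T : btree (seq L) :=
  if leaves T \in E then Leaf (leaves T) else
  match T with
  | Leaf _ => Leaf (leaves T)
  | Node l r => Node (cut E l) (cut E r)
  end.

Lemma flatten_cut E T : flatten (leaves (cut E T)) = leaves T.
Proof.
elim: T => [k|l IHl r IHr] /=; case: ifP => _ //=; rewrite ?cats0 //.
by rewrite flatten_cat IHl IHr.
Qed.

Lemma cut_blocks E T b : b \in leaves (cut E T) ->
  exists2 U, U \in vertices T & leaves U = b.
Proof.
elim: T => [k|l IHl r IHr] /=.
  case: ifP => _; rewrite mem_seq1 => /eqP->; exists (Leaf k) => //; exact: mem_head.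
case: ifP => _ /=.
  by rewrite mem_seq1 => /eqP->; exists (Node l r) => //; exact: mem_head.
rewrite mem_cat => /orP[/IHl|/IHr] [U h e]; exists U => //;
by rewrite in_cons mem_cat h ?orbT.
Qed.

Lemma cut_maximal E T U : U \in vertices T -> leaves U \in E ->
  exists2 b, b \in leaves (cut E T) & {subset leaves U <= b}.
Proof.
elim: T => [k|l IHl r IHr] UT UE.
  move: UT; rewrite mem_seq1 => /eqP e; exists [:: k]; last by rewrite e.
  by rewrite /=; case: ifP => _; rewrite mem_head.
have [TE|TE] := boolP (leaves (Node l r) \in E).
  exists (leaves (Node l r)); last exact: vertices_sub.
  by rewrite [cut _ _]/= -/(leaves (Node l r)) TE mem_head.
rewrite [cut _ _]/= -/(leaves (Node l r)) (negbTE TE) /=.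
move: UT; rewrite in_cons mem_cat => /or3P[/eqP e|h|h].
- by rewrite -e UE in TE.
- by have [b bl s] := IHl h UE; exists b; rewrite // mem_cat bl.
- by have [b bl s] := IHr h UE; exists b; rewrite // mem_cat bl orbT.
Qed.

Lemma cut_internal E T u : u \in internal_vertices (cut E T) ->
  exists U, [/\ U \in vertices T, is_internal U, leaves U \notin E & u = cut E U].
Proof.
elim: T => [k|l IHl r IHr]; first by rewrite /=; case: ifP.
have [TE|TE] := boolP (leaves (Node l r) \in E).
  by rewrite [cut _ _]/= -/(leaves (Node l r)) TE.
have cE : cut E (Node l r) = Node (cut E l) (cut E r).
  by rewrite [cut _ _]/= -/(leaves (Node l r)) (negbTE TE).
rewrite cE internal_Node in_cons mem_cat => /or3P[/eqP->|/IHl|/IHr].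
- by exists (Node l r); rewrite cE; split=> //; exact: mem_head.
- by case=> U [h1 h2 h3 ->]; exists U; split=> //; rewrite in_cons mem_cat h1 orbT.
- by case=> U [h1 h2 h3 ->]; exists U; split=> //; rewrite in_cons mem_cat h1 !orbT.
Qed.

Lemma uniq_flatten_blocks (B : seq (seq L)) :
  (forall b, b \in B -> b != [::]) -> uniq (flatten B) -> uniq B.
Proof.
elim: B => //= b B IH nz; rewrite cat_uniq => /and3P[_ /hasPn dis uf].
rewrite IH // => [|c cB]; last by apply: nz; rewrite in_cons cB orbT.
rewrite andbT; apply/negP => bB; have := nz b (mem_head _ _).
case: b bB dis {nz} => // x b bB dis _; have /dis : x \in flatten B.
  by apply/flattenP; exists (x :: b); rewrite // mem_head.
by rewrite /= mem_head.
Qed.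

(** Two partitions of the same list into intervals, each refining the other, are
    equal: the first blocks both contain the first element, hence each other. *)
Lemma blocks_eq (B C : seq (seq L)) :
  flatten B = flatten C -> uniq (flatten B) ->
  (forall b, b \in B -> b != [::]) -> (forall c, c \in C -> c != [::]) ->
  (forall b, b \in B -> exists2 c, c \in C & {subset b <= c}) ->
  (forall c, c \in C -> exists2 b, b \in B & {subset c <= b}) -> B = C.
Proof.
elim: B C => [|b B IH] [|c C] //.
- by move=> /= e _ _ /(_ c (mem_head _ _)); case: c e.
- by move=> /= e _ /(_ b (mem_head _ _)); case: b e.
move=> e u nB nC BC CB.
have [x [b' Eb]] : exists x b', b = x :: b'.
  by have := nB b (mem_head _ _); case: (b) => // x b' _; exists x, b'.
have [c' Ec] : exists c', c = x :: c'.
  have := nC c (mem_head _ _); move: e; rewrite Eb /=.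
  by case: (c) => //= y c' [-> _] _; exists c'.
have xb : x \in b by rewrite Eb mem_head.
have xc : x \in c by rewrite Ec mem_head.
have disj (D : seq (seq L)) d d' y : uniq (d ++ flatten D) -> y \in d ->
    d' \in D -> y \in d' -> False.
  rewrite cat_uniq => /and3P[_ /hasPn h _] yd d'D yd'.
  have /h /= : y \in flatten D by apply/flattenP; exists d'.
  by rewrite yd.
have u' : uniq (c ++ flatten C) by move: u; rewrite e.
have sbc : {subset b <= c}.
  have [d] := BC b (mem_head _ _); rewrite in_cons => /orP[/eqP-> //|dC s].
  by case: (disj _ _ _ _ u' xc dC (s _ xb)).
have scb : {subset c <= b}.
  have [d] := CB c (mem_head _ _); rewrite in_cons => /orP[/eqP-> //|dC s].
  by case: (disj _ _ _ _ u xb dC (s _ xc)).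
have [ub uc] : uniq b /\ uniq c by move: u u'; rewrite /= !cat_uniq => /and3P[? _ _] /and3P[].
have sz : size b = size c by apply/eqP; rewrite eqn_leq !uniq_leq_size.
have /andP[/eqP ebc /eqP eBC] : (b == c) && (flatten B == flatten C).
  by rewrite -eqseq_cat //; apply/eqP.
rewrite ebc; congr cons; apply: IH => //.
- by move: u; rewrite /= cat_uniq => /and3P[].
- by move=> d dB; apply: nB; rewrite in_cons dB orbT.
- by move=> d dB; apply: nC; rewrite in_cons dB orbT.
- move=> d dB; have [|d'] := BC d; first by rewrite in_cons dB orbT.
  rewrite in_cons => /orP[/eqP->|]; last by exists d'.
  have := nB d; rewrite in_cons dB orbT => /(_ isT); case: d dB => // y d dB _ s.
  by case: (disj _ _ _ y u _ dB (mem_head _ _)); apply/scb/s/mem_head.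
- move=> d dB; have [|d'] := CB d; first by rewrite in_cons dB orbT.
  rewrite in_cons => /orP[/eqP->|]; last by exists d'.
  have := nC d; rewrite in_cons dB orbT => /(_ isT); case: d dB => // y d dB _ s.
  by case: (disj _ _ _ y u' _ dB (mem_head _ _)); apply/sbc/s/mem_head.
Qed.

(** The default value [T] is returned for a list which is not that of a vertex. *)
Definition vertex_at T (b : seq L) : btree L :=
  nth T (vertices T) (find (fun u => leaves u == b) (vertices T)).

Lemma vertex_atP T U : uniq (leaves T) -> U \in vertices T ->
  vertex_at T (leaves U) = U.
Proof.
move=> uT UT; have h : has (fun u => leaves u == leaves U) (vertices T).
  by apply/hasP; exists U.
apply: (vertices_inj uT) => //; first by rewrite mem_nth // -has_find.
exact/eqP/(nth_find T h).
Qed.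

Lemma graft_cut E T : uniq (leaves T) ->
  relabel snd (graft (vertex_at T) (cut E T)) = T.
Proof.
move=> uT; suff h U : U \in vertices T -> relabel snd (graft (vertex_at T) (cut E U)) = U.
  exact/h/vertices_root.
have base V : V \in vertices T ->
    relabel snd (graft (vertex_at T) (Leaf (leaves V))) = V.
  by move=> VT; rewrite /= relabel_comp vertex_atP // (eq_relabel (g := id)) // relabel_id.
elim: U => [k|l IHl r IHr] UT.
  have -> : cut E (Leaf k) = Leaf (leaves (Leaf k)) by rewrite /=; case: ifP.
  exact: base.
rewrite [cut _ _]/=; case: ifP => _; first exact: (base _ UT).
have lT : l \in vertices T.
  by apply: vertices_trans UT; rewrite in_cons mem_cat vertices_root orbT.
have rT : r \in vertices T.
  by apply: vertices_trans UT; rewrite in_cons mem_cat vertices_root !orbT.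
by rewrite /= IHl ?IHr.
Qed.

Definition common_proper T S : seq (seq L) :=
  [seq s <- map (@leaves L) (vertices T) |
     (s \in map (@leaves L) (vertices S)) && (size s < size (leaves T))].

Lemma leaf_vertex T x : x \in leaves T -> Leaf x \in vertices T.
Proof.
elim: T => [k|l IHl r IHr] /=; first by rewrite !mem_seq1 => /eqP->.
by rewrite in_cons !mem_cat => /orP[/IHl->|/IHr->]; rewrite !orbT.
Qed.

Lemma cut_block_in E T b : (forall x, x \in leaves T -> [:: x] \in E) ->
  b \in leaves (cut E T) -> b \in E.
Proof.
elim: T => [k|l IHl r IHr] hE /=.
  by rewrite hE ?mem_head //= mem_seq1 => /eqP->; rewrite hE ?mem_head.
case: ifP => h; first by rewrite /= mem_seq1 => /eqP->.
rewrite mem_cat => /orP[/IHl|/IHr]; apply=> x xi;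
by apply: hE; rewrite /= mem_cat xi ?orbT.
Qed.

(** Both lists of leaves are sublists of the same duplicate-free list. *)
Lemma vertices_perm_eq T S U V : uniq (leaves T) -> leaves T = leaves S ->
  U \in vertices T -> V \in vertices S -> perm_eq (leaves U) (leaves V) ->
  leaves U = leaves V.
Proof.
move=> uT ST /vertices_subseq sU /vertices_subseq; rewrite -ST => sV p.
move: (subseq_uniqP uT sU) (subseq_uniqP uT sV) => -> ->.
by apply: eq_filter => x; rewrite /= (perm_mem p).
Qed.

(** Both trees are cut at the maximal elements of the same family of proper common
    lists of leaves, hence along the same partition of the layout.  A leaf-matched
    pair of the skeleton expands to a common list of leaves that was not cut at,
    so the pair is not proper. *)
Lemma decompose (A : tangle L) : aligned A -> 1 < tgsize A ->
  exists (I : tangle (seq L)) (g : seq L -> tangle L),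
    [/\ aligned I, tirreducible I, 1 < tgsize I, {in leaves I.1, forall b, aligned (g b)}
      & relabel_tangle snd (fill I g) = A].
Proof.
case: A => T S /andP[/= uT /eqP ST]; rewrite /tgsize /= => sz.
have uS : uniq (leaves S) by rewrite -ST.
pose E := common_proper T S.
have EP s : s \in E -> exists U V, [/\ U \in vertices T, V \in vertices S,
    leaves U = s, leaves V = s & size s < size (leaves T)].
  rewrite mem_filter => /andP[/andP[/mapP[V VS e2] h] /mapP[U UT e1]].
  by exists U, V.
have EI U V : U \in vertices T -> V \in vertices S -> leaves U = leaves V ->
    size (leaves U) < size (leaves T) -> leaves U \in E.
  move=> UT VS e h; rewrite mem_filter h andbT; apply/andP; split; last exact: map_f.
  by rewrite e; apply: map_f.
have E1 x : x \in leaves T -> [:: x] \in E.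
  by move=> xT; apply: (EI (Leaf x) (Leaf x)); rewrite ?leaf_vertex // -ST.
have nz W b : b \in leaves (cut E W) -> b != [::].
  by case/cut_blocks => U _ <-; rewrite -size_eq0 -lt0n size_leaves_gt0.
have eB : leaves (cut E T) = leaves (cut E S).
  apply: blocks_eq; rewrite ?flatten_cut //.
  - by move=> b; apply: nz.
  - by move=> b; apply: nz.
  - move=> b /(cut_block_in E1) bE; have [U [V [_ VS _ eV _]]] := EP _ bE.
    by rewrite -eV; apply: cut_maximal => //; rewrite eV.
  - move=> b; rewrite ST in E1; move/(cut_block_in E1) => bE.
    have [U [V [UT _ eU _ _]]] := EP _ bE.
    by rewrite -eU; apply: cut_maximal => //; rewrite eU.
have uB : uniq (leaves (cut E T)).
  by apply: uniq_flatten_blocks; [move=> b; exact: nz|rewrite flatten_cut].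
have TE : leaves T \in E = false.
  by apply/negP => /EP[U [V [_ _ _ _]]]; rewrite ltnn.
exists (cut E T, cut E S), (fun b => (vertex_at T b, vertex_at S b)).
split.
- by rewrite /aligned uB /= eB.
- move=> u v /= /cut_internal[U [UT Ui UE ->]] /cut_internal[V [VS Vi VE ->]] p.
  have e : leaves U = leaves V.
    apply: (vertices_perm_eq uT ST) => //.
    rewrite -(flatten_cut E U) -(flatten_cut E V); exact: perm_flatten.
  suff -> : U = T by [].
  apply: vertices_size_eq => //; rewrite leqNgt; apply/negP => h.
  by have := EI U V UT VS e h; rewrite (negbTE UE).
- rewrite /tgsize [fst _]/=; clearbody E; case: (T) sz TE => // l r _ TE.
  rewrite [cut _ _]/= -/(leaves (Node l r)) TE /= size_cat.
  have := size_leaves_gt0 (cut E l); have := size_leaves_gt0 (cut E r); lia.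
- move=> b /(cut_block_in E1) bE; have [U [V [UT VS eU eV _]]] := EP _ bE.
  have a1 : vertex_at T b = U by rewrite -eU vertex_atP.
  have a2 : vertex_at S b = V by rewrite -eV vertex_atP.
  by rewrite /aligned /= a1 a2 eU eV eqxx andbT -eU (vertices_uniq UT).
- by rewrite /relabel_tangle /= !graft_cut.
Qed.

End Cut.

(** * Layouts and isomorphism classes *)
Section Layout.
Variable L : eqType.
Implicit Types (T : btree L) (s X : seq L).

(** Stability under betweenness: unlike contiguity in terms of positions, this
    form is inherited by the two halves of [X]. *)
Definition convex s X := forall x y z, x \in s -> z \in s -> y \in X ->
  index x X <= index y X <= index z X -> y \in s.

Lemma convex_infix A B C : uniq (A ++ B ++ C) -> convex B (A ++ B ++ C).
Proof.
move=> u x y z xB zB; move: u; rewrite !cat_uniq => /and4P[_ /hasPn dA _ /andP[/hasPn dC _]].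
have nA w : w \in B -> w \in A = false.
  by move=> wB; apply/negP => wA; have := dA w; rewrite mem_cat wB /= wA => /(_ isT).
rewrite !index_cat (nA _ xB) (nA _ zB) xB zB !mem_cat => /or3P[yA|//|yC].
- by rewrite yA leqNgt ltn_addr // index_mem.
- case: ifP => [yA|_]; first by have := dA y; rewrite mem_cat yC orbT /= yA => /(_ isT).
  have /negbTE /= -> := dC _ yC.
  by rewrite !leq_add2l => /andP[_]; rewrite leqNgt ltn_addr // index_mem.
Qed.

Lemma convex_perm s s' X : perm_eq s s' -> convex s X -> convex s' X.
Proof. by move=> p h x y z; rewrite -!(perm_mem p); apply: h. Qed.

Lemma convex_catl s A B : {subset s <= A} -> convex s (A ++ B) -> convex s A.
Proof.
move=> sA h x y z xs zs yA; have := h x y z xs zs.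
by rewrite !index_cat mem_cat yA !sA //; apply.
Qed.

Lemma convex_catr s A B : uniq (A ++ B) -> {subset s <= B} -> convex s (A ++ B) -> convex s B.
Proof.
rewrite cat_uniq => /and3P[_ /hasPn d _] sB h x y z xs zs yB le; apply: (h x y z) => //.
  by rewrite mem_cat yB orbT.
rewrite !index_cat (negbTE (d _ yB)) (negbTE (d _ (sB _ xs))) (negbTE (d _ (sB _ zs))).
by rewrite !leq_add2l.
Qed.

(** The hypothesis says that in [X] no element outside [p] precedes one in [p]. *)
Lemma filter_prefix (p : pred L) X : pairwise (fun a b => p b ==> p a) X ->
  X = filter p X ++ filter (predC p) X.
Proof.
elim: X => //= x X IH /andP[ax /IH e].
case: ifP => px /=; first by rewrite -e.
rewrite (@eq_in_filter _ p pred0); last first.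
  by move=> y /(allP ax); rewrite px implybF => /negbTE.
rewrite filter_pred0 (@eq_in_filter _ (predC p) predT) ?filter_predT //.
by move=> y /(allP ax); rewrite px implybF.
Qed.

Lemma convex_prefix_split s s' x X : uniq (x :: X) -> x \in s -> convex s (x :: X) ->
  perm_eq (x :: X) (s ++ s') ->
  exists A B, [/\ x :: X = A ++ B, perm_eq A s & perm_eq B s'].
Proof.
move=> uX xs cs p; set Y := x :: X in uX cs p *.
have uss : uniq (s ++ s') by rewrite -(perm_uniq p).
have sub y : y \in s -> y \in Y by move=> ys; rewrite (perm_mem p) mem_cat ys.
exists (filter (mem s) Y), (filter (predC (mem s)) Y); split.
- apply: filter_prefix; apply/(pairwiseP x) => i j.
  rewrite !inE => iY jY ij; apply/implyP => /= js; apply: (cs x _ _ xs js).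
    exact: mem_nth.
  by rewrite !index_uniq // (ltnW ij) andbT /Y /= eqxx.
- apply: uniq_perm; first exact: filter_uniq.
    by move: uss; rewrite cat_uniq => /and3P[].
  move=> y; rewrite mem_filter /=; case ys: (y \in s) => //=; exact: sub.
- apply: uniq_perm; first exact: filter_uniq.
    by move: uss; rewrite cat_uniq => /and3P[].
  move=> y; rewrite mem_filter /= (perm_mem p) mem_cat.
  case ys: (y \in s) => //=; move: uss; rewrite cat_uniq => /and3P[_ /hasPn d _].
  by apply/esym/negP => /d /=; rewrite ys.
Qed.

(** An order in which the leaves below every vertex are consecutive comes from a
    drawing of the tree: the child above the first leaf has a prefix of the order
    below it, so it can be drawn on the left. *)
Lemma tree_of_layout T X : uniq X -> perm_eq X (leaves T) ->
  (forall u, u \in vertices T -> convex (leaves u) X) ->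
  exists2 T', tree_sim T T' & leaves T' = X.
Proof.
elim: T X => [k|l IHl r IHr] X uX p cX.
  by exists (Leaf k); rewrite ?tree_sim_refl //; apply/esym/perm_small_eq.
have split_sim (l1 r1 : btree L) A B : X = A ++ B ->
    perm_eq A (leaves l1) -> perm_eq B (leaves r1) ->
    {subset vertices l1 <= vertices (Node l r)} ->
    {subset vertices r1 <= vertices (Node l r)} ->
    (forall Z, uniq Z -> perm_eq Z (leaves l1) ->
      (forall u, u \in vertices l1 -> convex (leaves u) Z) ->
      exists2 T', tree_sim l1 T' & leaves T' = Z) ->
    (forall Z, uniq Z -> perm_eq Z (leaves r1) ->
      (forall u, u \in vertices r1 -> convex (leaves u) Z) ->
      exists2 T', tree_sim r1 T' & leaves T' = Z) ->
    exists l' r', [/\ tree_sim l1 l', tree_sim r1 r' & leaves (Node l' r') = X].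
  move=> eX pA pB sl sr h1 h2.
  have [uA uB] : uniq A /\ uniq B by move: uX; rewrite eX cat_uniq => /and3P[].
  have [|l' s1 e1] := h1 A uA pA.
    move=> u ul; apply: (@convex_catl _ _ B); last by rewrite -eX; apply/cX/sl.
    by move=> x xu; rewrite (perm_mem pA) (vertices_sub ul).
  have [|r' s2 e2] := h2 B uB pB.
    move=> u ur; apply: (@convex_catr _ A); rewrite -?eX //; last by apply/cX/sr.
    by move=> x xu; rewrite (perm_mem pB) (vertices_sub ur).
  by exists l', r'; split; rewrite //= e1 e2.
have sl : {subset vertices l <= vertices (Node l r)}.
  by move=> u ul; rewrite in_cons mem_cat ul orbT.
have sr : {subset vertices r <= vertices (Node l r)}.
  by move=> u ur; rewrite in_cons mem_cat ur !orbT.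
case: X uX p cX split_sim => [|x X] uX p cX split_sim.
  by have := perm_size p; have := size_leaves_gt0 (Node l r); move=> /[swap] <-.
have := mem_head x X; rewrite (perm_mem p) /= mem_cat => /orP[xl|xr].
  have [A [B [e pA pB]]] := convex_prefix_split uX xl (cX _ (sl _ (vertices_root l))) p.
  have [l' [r' [s1 s2 e']]] := split_sim l r A B e pA pB sl sr IHl IHr.
  by exists (Node l' r'); rewrite //= s1 s2.
have p' : perm_eq (x :: X) (leaves r ++ leaves l) by rewrite perm_sym perm_catC perm_sym.
have [A [B [e pA pB]]] := convex_prefix_split uX xr (cX _ (sr _ (vertices_root r))) p'.
have [l' [r' [s1 s2 e']]] := split_sim r l A B e pA pB sr sl IHr IHl.
by exists (Node l' r'); rewrite //= s1 s2 orbT.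
Qed.

Lemma vertices_infix T u : u \in vertices T ->
  exists A C, leaves T = A ++ leaves u ++ C.
Proof.
elim: T => [k|l IHl r IHr].
  by rewrite mem_seq1 => /eqP->; exists [::], [::].
rewrite in_cons mem_cat => /or3P[/eqP->|/IHl|/IHr].
- by exists [::], [::]; rewrite cats0.
- by case=> A [C e]; exists A, (C ++ leaves r); rewrite /= e -!catA.
- by case=> A [C e]; exists (leaves l ++ A), C; rewrite /= e -!catA.
Qed.

Lemma same_order X Y : uniq X -> uniq Y -> X =i Y ->
  (forall x y, x \in X -> y \in X -> (index x X < index y X) = (index x Y < index y Y)) ->
  X = Y.
Proof.
move=> uX uY e h; pose r := relpre (index^~ Y) ltn.
have srt (Z : seq L) : uniq Z -> (forall x y, x \in Z -> y \in Z ->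
    (index x Z < index y Z) = (index x Y < index y Y)) -> sorted r Z.
  case: Z => // z Z' uZ hZ; set Z := z :: Z' in uZ hZ *; apply/(sortedP z) => i lti.
  have := hZ (nth z Z i) (nth z Z i.+1); rewrite !mem_nth ?(ltnW lti) //.
  by rewrite !index_uniq ?(ltnW lti) // ltnSn => /(_ isT isT) e1; apply/esym.
apply: (@irr_sorted_eq _ r) => //.
- by move=> a b c; apply: ltn_trans.
- by move=> a; rewrite /r /= ltnn.
- exact: srt.
- exact: srt.
Qed.

End Layout.

Section Bridge.
Variable n : nat.
Implicit Types t : tanglegram n.

(** The second tree is relabelled by the inverse matching, which turns [t] into a
    pair of trees whose matched leaves have equal labels. *)
Definition ord_tangle t : tangle 'I_n :=
  (fst_tree t : btree 'I_n, relabel (matching t)^-1%g (snd_tree t)).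

Lemma perm_enum_ord (s : seq 'I_n) : uniq s -> size s = n -> perm_eq s (enum 'I_n).
Proof.
move=> us sz; apply: uniq_perm; rewrite ?enum_uniq //.
have [] // := @uniq_min_size _ s (enum 'I_n) us; last by rewrite size_enum_ord sz.
by move=> x _; rewrite mem_enum.
Qed.

Lemma leaves_perm_ord (T : ltree n) (f : 'I_n -> 'I_n) : injective f ->
  perm_eq (map f (leaves T)) (enum 'I_n).
Proof.
move=> fi; have p := ltreeP T; apply: perm_enum_ord.
  by rewrite map_inj_uniq // (perm_uniq p) enum_uniq.
by rewrite size_map (perm_size p) size_enum_ord.
Qed.

Lemma ord_tangle_valid t : valid (ord_tangle t).
Proof.
have p1 := ltreeP (fst_tree t); rewrite /valid /= (perm_uniq p1) enum_uniq.
rewrite leaves_relabel (perm_trans p1) // perm_sym leaves_perm_ord //.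
exact: perm_inj.
Qed.

Lemma ord_tangle_size t : tgsize (ord_tangle t) = n.
Proof. by rewrite /tgsize /= (perm_size (ltreeP _)) size_enum_ord. Qed.

Lemma tg_iso_tiso t t' : tg_iso t t' <-> tiso (ord_tangle t) (ord_tangle t').
Proof.
split=> [/tg_isoP[s [u [h1 h2 h3]]]|[f i]].
  exists s; apply/andP; split=> //=; rewrite relabel_comp.
  rewrite (@eq_relabel _ _ _ ((matching t')^-1%g \o u)); last first.
    move=> x /=; apply: (@perm_inj _ (matching t')).
    by rewrite h3 !permKV.
  by rewrite -relabel_comp tree_sim_relabel.
have fi : injective f.
  move=> x y; have := tiso_by_inj (ord_tangle_valid t') i.
  by apply; rewrite (perm_mem (ltreeP _)) mem_enum.
have fE : perm fi =1 f by move=> x; rewrite permE.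
case/andP: i => /= s1 s2; apply/tg_isoP.
exists (perm fi), ((matching t)^-1 * (perm fi * matching t'))%g; split.
- by rewrite (eq_relabel fE).
- have := tree_sim_relabel (matching t') s2; rewrite !relabel_comp.
  rewrite (eq_relabel (f := matching t' \o (matching t')^-1%g) (g := id)) ?relabel_id; last first.
    by move=> x /=; rewrite permKV.
  by rewrite [X in tree_sim X _ -> _](eq_relabel (g := ((matching t)^-1 * (perm fi * matching t'))%g)) // => x;
     rewrite /= !permM fE.
- by move=> x; rewrite !permM permK.
Qed.

Lemma num_matched_ord t : num_matched (ord_tangle t) = size (leaf_matched_pairs t).
Proof.
rewrite /leaf_matched_pairs size_filter -sum1_count big_mkcond big_allpairs /num_matched.
apply: eq_bigr => u _ /=; rewrite internal_relabel big_map; apply: eq_bigr => v _.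
rewrite leaves_relabel /leaf_matched.
have -> : perm_eq (leaves u) (map (matching t)^-1%g (leaves v)) =
          perm_eq (map (matching t) (leaves u)) (leaves v).
  have e : map (matching t) (map (matching t)^-1%g (leaves v)) = leaves v.
    by rewrite -map_comp -[RHS]map_id; apply: eq_map => x; apply: permKV.
  rewrite -[in RHS]e (@perm_map_inj_in _ _ (matching t) (enum 'I_n)) //.
  - by move=> x y _ _; apply: perm_inj.
  - by move=> x _; rewrite mem_enum.
  - by move=> x _; rewrite mem_enum.
by case: perm_eq.
Qed.

Lemma irreducible_num_matched t : irreducible t = (1 < n) && (num_matched (ord_tangle t) == 1).
Proof.
rewrite /irreducible num_matched_ord; case: ltnP => //= n1.
have sz1 : size (leaves (fst_tree t)) = n.
  by rewrite (perm_size (ltreeP _)) size_enum_ord.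
have sz2 : size (leaves (snd_tree t)) = n.
  by rewrite (perm_size (ltreeP _)) size_enum_ord.
have root : leaf_matched (matching t) (fst_tree t) (snd_tree t).
  rewrite /leaf_matched (perm_trans (leaves_perm_ord _ (@perm_inj _ _))) //.
  by rewrite perm_sym ltreeP.
have int (T : btree 'I_n) : size (leaves T) = n ->
    exists r, internal_vertices T = T :: r.
  case: T => [a|l r] /= sz; first by rewrite -sz in n1.
  by rewrite internal_Node; exists (internal_vertices l ++ internal_vertices r).
have [r1 e1] := int _ sz1; have [r2 e2] := int _ sz2.
rewrite /leaf_matched_pairs e1 e2 /= root.
by case: (X in _ :: X == _) => //= *; rewrite eqseq_cons eqxx.
Qed.

Lemma consecutive_convex (s X : seq 'I_n) : uniq X -> consecutive s X -> convex s X.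
Proof.
move=> uX /existsP[k p].
have e : X = take k X ++ take (size s) (drop k X) ++ drop (size s) (drop k X).
  by rewrite !cat_take_drop.
have := @convex_infix _ (take k X) (take (size s) (drop k X)) (drop (size s) (drop k X)).
by rewrite -e => /(_ uX) /(convex_perm p).
Qed.

Lemma leaf_order_sim (T T' : btree 'I_n) : tree_sim T T' -> leaf_order T (leaves T').
Proof.
move=> s; apply/andP; split; first by rewrite perm_sym tree_sim_leaves.
apply/allP => u uT; have [u' u'T su] := tree_sim_vertex s uT.
have p := tree_sim_leaves su; have [A [C e]] := vertices_infix u'T.
have kP : size A < (size (leaves T')).+1 by rewrite e size_cat ltnS leq_addr.
apply/existsP; exists (Ordinal kP); rewrite /= e drop_size_cat // (perm_size p).
by rewrite take_size_cat // perm_sym.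
Qed.

(** Without crossings the matching transports the order of the first tree to that
    of the second tree, so the two drawings are aligned after relabelling. *)
Lemma planar_ord t : planar t <-> tplanar (ord_tangle t).
Proof.
have inT (T : ltree n) x : x \in leaves T by rewrite (perm_mem (ltreeP _)) mem_enum.
split=> [/existsP[X /existsP[Y /and3P[oX oY /forallP nc]]]|].
  have tree (T : ltree n) (Z : seq 'I_n) : leaf_order T Z ->
      uniq Z /\ exists2 T', tree_sim T T' & leaves T' = Z.
    case/andP=> p /allP h; have u : uniq Z.
      by rewrite (perm_uniq p) (perm_uniq (ltreeP _)) enum_uniq.
    split=> //; apply: tree_of_layout => // v /h; exact: consecutive_convex.
  have [uX [T' sT eT]] := tree _ _ oX; have [uY [S' sS eS]] := tree _ _ oY.
  have inX x : x \in tval X by have /andP[p _] := oX; rewrite (perm_mem p) inT.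
  have inY x : x \in tval Y by have /andP[p _] := oY; rewrite (perm_mem p) inT.
  have eY : map (matching t) X = Y.
    apply: same_order => //.
    - by rewrite map_inj_uniq //; apply: perm_inj.
    - by move=> x; rewrite inY; apply/mapP; exists ((matching t)^-1%g x); rewrite ?permKV.
    - move=> _ _ /mapP[x _ ->] /mapP[y _ ->].
      rewrite !index_map; try exact: perm_inj.
      by have /forallP/(_ y) := nc x; rewrite /crosses; do 2 case: (_ < _).
  exists (T', relabel (matching t)^-1%g S').
    rewrite /aligned /= leaves_relabel eT eS -eY uX -map_comp.
    by rewrite (eq_map (g := id)) ?map_id ?eqxx // => x /=; rewrite permK.
  by rewrite /tsim /= sT tree_sim_relabel.
case=> -[T' S'] /andP[/= u /eqP e] /andP[/= sT sS].
have pT := tree_sim_leaves sT.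
have szX : size (leaves T') == n.
  by rewrite -(perm_size pT) (perm_size (ltreeP _)) size_enum_ord.
have szY : size (map (matching t) (leaves T')) == n by rewrite size_map.
apply/existsP; exists (Tuple szX); apply/existsP; exists (Tuple szY).
apply/and3P; split; first exact: leaf_order_sim.
  rewrite /= e -leaves_relabel; apply: leaf_order_sim.
  have := tree_sim_relabel (matching t) sS; rewrite relabel_comp.
  by rewrite [X in tree_sim X _ -> _](eq_relabel (g := id)) ?relabel_id // => x /=; rewrite permKV.
apply/forallP => x; apply/forallP => y; rewrite /crosses /=.
by rewrite !index_map ?addbb //; apply: perm_inj.
Qed.

Lemma exists_tanglegram (L : eqType) (A : tangle L) : valid A -> tgsize A = n ->
  exists t, tiso A (ord_tangle t).
Proof.
move=> vA sz; have n0 : 0 < n by rewrite -sz size_leaves_gt0.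
pose f x : 'I_n := insubd (Ordinal n0) (index x (leaves A.1)).
have fi : {in leaves A.1 &, injective f}.
  move=> x y xA yA /(congr1 val); rewrite !val_insubd.
  have lt z : z \in leaves A.1 -> index z (leaves A.1) < n by rewrite -sz index_mem.
  by rewrite !lt // => /index_inj; apply.
have /andP[u p] := relabel_valid fi vA.
have p1 : perm_eq (leaves (relabel f A.1)) (enum 'I_n).
  by apply: perm_enum_ord; rewrite // leaves_relabel size_map.
have p2 : perm_eq (leaves (relabel f A.2)) (enum 'I_n).
  by rewrite -(permPl p).
exists (Tanglegram (LTree p1) (LTree p2) 1%g), f.
rewrite /tiso_by /ord_tangle /= invg1 (eq_relabel (g := id)) ?relabel_id; last exact: perm1.
exact: tsim_refl.
Qed.

(** Natural number labels allow tanglegrams of different sizes in one list. *)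
Definition nat_tangle t : tangle nat := relabel_tangle val (ord_tangle t).

Lemma nat_tangle_valid t : valid (nat_tangle t).
Proof. by apply: relabel_valid (ord_tangle_valid t) => x y _ _ /val_inj. Qed.

Lemma nat_ord_tiso t : tiso (nat_tangle t) (ord_tangle t).
Proof.
apply: tiso_sym; rewrite ?nat_tangle_valid ?ord_tangle_valid //.
by exists val; apply: relabel_tiso_by.
Qed.

Lemma ord_nat_tiso t : tiso (ord_tangle t) (nat_tangle t).
Proof. by exists val; apply: relabel_tiso_by. Qed.

Lemma nat_tangle_tiso t t' : tg_iso t t' <-> tiso (nat_tangle t) (nat_tangle t').
Proof.
rewrite tg_iso_tiso; split=> h.
  exact: tiso_trans (nat_ord_tiso t) (tiso_trans h (ord_nat_tiso t')).
exact: tiso_trans (ord_nat_tiso t) (tiso_trans h (nat_ord_tiso t')).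
Qed.

Lemma nat_tangle_leaves t : leaves (nat_tangle t).1 =i iota 0 n.
Proof.
move=> k; rewrite leaves_relabel mem_iota add0n /=; apply/mapP/idP => [[x _ ->]|h].
  exact: ltn_ord.
by exists (Ordinal h); rewrite // (perm_mem (ltreeP _)) mem_enum.
Qed.

Definition planar_classes : seq (tg_class n) :=
  [seq c <- enum {: tg_class n} | planar (class_repr c)].
Definition planar_reps : seq (tangle nat) :=
  [seq nat_tangle (class_repr c) | c <- planar_classes].

Lemma tg_pi_eq t t' :
  (\pi_(tg_class n) t = \pi_(tg_class n) t')%qT <-> tg_iso t t'.
Proof. exact: rwP (generic_quotient.eqmodP (tg_iso_equiv n) t t'). Qed.

Lemma tg_class_eq (c c' : tg_class n) :
  tg_iso (class_repr c) (class_repr c') -> c = c'.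
Proof.
move=> h; rewrite -[c]generic_quotient.reprK -[c']generic_quotient.reprK.
exact/tg_pi_eq.
Qed.

Lemma nat_tangle_tplanar t : planar t <-> tplanar (nat_tangle t).
Proof.
rewrite planar_ord; split; apply: tiso_tplanar;
  rewrite ?nat_tangle_valid ?ord_tangle_valid //; [exact: ord_nat_tiso|exact: nat_ord_tiso].
Qed.

Lemma nat_tangle_num_matched t : num_matched (nat_tangle t) = size (leaf_matched_pairs t).
Proof.
by rewrite -num_matched_ord; apply: tiso_num_matched;
   rewrite ?nat_tangle_valid ?ord_tangle_valid //; exact: nat_ord_tiso.
Qed.

Lemma planar_repsP A : A \in planar_reps ->
  [/\ tplanar A, tgsize A = n & leaves A.1 =i iota 0 n].
Proof.
case/mapP=> c; rewrite mem_filter => /andP[/nat_tangle_tplanar pc _] ->.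
split=> //; last exact: nat_tangle_leaves.
by rewrite relabel_size ord_tangle_size.
Qed.

Lemma planar_reps_inj A B : A \in planar_reps -> B \in planar_reps ->
  tiso A B -> A = B.
Proof. by case/mapP=> c _ -> /mapP[c' _ ->] /nat_tangle_tiso /tg_class_eq ->. Qed.

Lemma planar_reps_uniq : uniq planar_reps.
Proof.
rewrite map_inj_in_uniq => [|c c' _ _ e]; first by apply: filter_uniq; apply: enum_uniq.
apply/tg_class_eq/nat_tangle_tiso; rewrite e.
by exists id; rewrite /tiso_by relabel_tangle_id tsim_refl.
Qed.

Lemma planar_reps_complete (L : eqType) (A : tangle L) : tplanar A -> tgsize A = n ->
  exists2 B, B \in planar_reps & tiso A B.
Proof.
move=> pA sz; have vA := tplanar_valid pA.
have [t i] := exists_tanglegram vA sz.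
pose c : tg_class n := (\pi t)%qT.
have tc : tg_iso t (class_repr c).
  by apply/tg_pi_eq; rewrite /class_repr generic_quotient.reprK.
have iA : tiso A (nat_tangle (class_repr c)).
  by apply: tiso_trans i (tiso_trans (proj1 (tg_iso_tiso _ _) tc) (ord_nat_tiso _)).
exists (nat_tangle (class_repr c)) => //; apply: map_f.
rewrite mem_filter mem_enum andbT; apply/nat_tangle_tplanar.
exact: tiso_tplanar (nat_tangle_valid _) iA pA.
Qed.

Definition irreducible_reps : seq (tangle nat) :=
  [seq A <- planar_reps | (1 < n) && (num_matched A == 1)].

End Bridge.

(** * Enumeration of the composites *)
Definition tangle0 : tangle nat := (Leaf 0, Leaf 0).

(** The sequences of [m] representatives with [n] leaves in total, organised by the
    size of the first one, which is the recursion satisfied by the coefficients of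
    a power of a series. *)
Fixpoint forests (m n : nat) : seq (seq (tangle nat)) :=
  if m is m'.+1 then
    [seq Ap.1 :: Ap.2 | i <- iota 0 n.+1,
       Ap <- [seq (A, ps) | A <- planar_reps i, ps <- forests m' (n - i)]]
  else if n == 0 then [:: [::]] else [::].

Lemma planar_reps_tgsize n A : A \in planar_reps n -> tgsize A = n.
Proof. by case/planar_repsP. Qed.

Definition reps_forest (ps : seq (tangle nat)) := all (fun A => A \in planar_reps (tgsize A)) ps.

Lemma forestsS m n : forests m.+1 n =
  [seq Ap.1 :: Ap.2 | i <- iota 0 n.+1,
     Ap <- [seq (A, ps) | A <- planar_reps i, ps <- forests m (n - i)]].
Proof. by []. Qed.

Lemma forestsP m n ps : (ps \in forests m n) =
  [&& size ps == m, reps_forest ps & sumn (map (@tgsize nat) ps) == n].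
Proof.
elim: m n ps => [|m IH] n ps.
  by case: ps => [|A ps] /=; case: n.
apply/allpairsPdep/idP.
  case=> i [[A qs] []]; rewrite mem_iota => /andP[_ lei] /allpairsP[[A' qs'] /= [hA hq [-> ->]]].
  move=> ->; rewrite /=; move: hq; rewrite IH => /and3P[/eqP-> ->].
  rewrite (planar_reps_tgsize hA) hA /= eqxx => /eqP->; lia.
case: ps => [|A ps] //= /and3P[sz /andP[hA hp] sm].
exists (tgsize A), (A, ps); split=> //; first by rewrite -[_ :: _]/(iota 0 n.+1) mem_iota /= add0n ltnS -(eqP sm) leq_addr.
by apply: allpairs_f => //; rewrite IH -eqSS sz hp /= -(eqP sm) addKn.
Qed.

(** The lists [t i] are disjoint because [key] recovers the index. *)
Lemma uniq_flatten_key (X : eqType) (key : X -> nat) (s : seq nat) (t : nat -> seq X) :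
  uniq s -> {in s, forall i, uniq (t i)} ->
  {in s, forall i x, x \in t i -> key x = i} -> uniq (flatten (map t s)).
Proof.
elim: s => //= i s IH /andP[nis us] ut kt; rewrite cat_uniq ut ?mem_head //=.
rewrite IH // => [|j js|j js]; [|by apply: ut; rewrite in_cons js orbT
  |by apply: kt; rewrite in_cons js orbT].
rewrite andbT; apply/hasPn => x /flatten_mapP[j js xj]; apply/negP => xi.
have kj : key x = j by apply: kt xj; rewrite in_cons js orbT.
by rewrite -(kt i (mem_head _ _) x xi) kj js in nis.
Qed.

Lemma forests_uniq m n : uniq (forests m n).
Proof.
elim: m n => [|m IH] n; first by rewrite /=; case: ifP.
rewrite forestsS; apply: (@uniq_flatten_key _ (fun ps => tgsize (head tangle0 ps))).
- exact: iota_uniq.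
- move=> i _; rewrite map_inj_in_uniq => [|[A ps] [B qs] _ _ /= [-> ->]] //.
  apply: allpairs_uniq; rewrite ?planar_reps_uniq //.
  by case=> [a b] [c d] _ _ /= [-> ->].
- move=> i _ _ /mapP[Ap /allpairsP[[A ps] [/= hA _ ->]] ->] /=.
  exact: planar_reps_tgsize hA.
Qed.

(** Two tanglegrams grafted on a skeleton with two leaves may be exchanged; one of
    the two orders is selected by means of the injection [pickle] into [nat]. *)
Definition ordered (ps : seq (tangle nat)) : bool :=
  (size ps == 2) ==>
  (pickle (nth tangle0 ps 0) <= pickle (nth tangle0 ps 1)).

(** A code is a skeleton with the sequence of tanglegrams to graft on it: the
    labels of a representative are 0, ..., m - 1, and [assemble] grafts the k-th
    item of the sequence on the leaf with label k. *)
Definition codes (m n : nat) : seq (tangle nat * seq (tangle nat)) :=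
  [seq (B, ps) | B <- irreducible_reps m, ps <- filter ordered (forests m n)].

Definition all_codes (n : nat) : seq (tangle nat * seq (tangle nat)) :=
  [seq c | m <- iota 0 n.+1, c <- codes m n].

Definition assemble (c : tangle nat * seq (tangle nat)) : tangle (nat * nat) :=
  fill c.1 (nth tangle0 c.2).

Lemma irreducible_repsP m I : I \in irreducible_reps m ->
  [/\ tplanar I, tirreducible I, tgsize I = m, 1 < m & leaves I.1 =i iota 0 m].
Proof.
rewrite mem_filter => /andP[/andP[m1 /eqP l1] /planar_repsP[h1 h2 h3]]; split=> //.
by apply/num_matched_eq1; rewrite ?h2 //; apply: tplanar_valid.
Qed.

Lemma in_irreducible_reps m I : I \in planar_reps m -> 1 < m -> tirreducible I ->
  I \in irreducible_reps m.
Proof.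
move=> Ir m1 iI; rewrite mem_filter Ir m1 andbT /=.
by have [h1 h2 _] := planar_repsP Ir; apply/eqP/num_matched_eq1; rewrite ?h2 //; apply: tplanar_valid.
Qed.

Lemma codesP m n I ps : ((I, ps) \in codes m n) =
  [&& I \in irreducible_reps m, ps \in forests m n & ordered ps].
Proof.
apply/allpairsP/idP => [[[J qs] /= [h1 h2 [-> ->]]]|/and3P[h1 h2 h3]].
  by rewrite h1; move: h2; rewrite mem_filter => /andP[-> ->].
by exists (I, ps); rewrite h1 mem_filter h2 h3.
Qed.

Lemma sum_labels_nth (R : nmodType) m (I : tangle nat) ps (w : tangle nat -> R) :
  uniq (leaves I.1) -> leaves I.1 =i iota 0 m -> size ps = m ->
  (\sum_(k <- leaves I.1) w (nth tangle0 ps k) = \sum_(A <- ps) w A)%R.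
Proof.
move=> u e sz; rewrite (big_nth tangle0) sz /index_iota subn0.
by apply: perm_big; apply: uniq_perm; rewrite ?iota_uniq.
Qed.

Lemma codes_nth m n I ps k : (I, ps) \in codes m n -> k \in leaves I.1 ->
  nth tangle0 ps k \in planar_reps (tgsize (nth tangle0 ps k)).
Proof.
rewrite codesP forestsP => /and3P[/irreducible_repsP[_ _ _ _ e] /and3P[/eqP sz rf _] _].
by rewrite e mem_iota add0n -sz => /andP[_ lt]; apply: (allP rf); apply: mem_nth.
Qed.

Lemma codes_nth_tplanar m n I ps k : (I, ps) \in codes m n -> k \in leaves I.1 ->
  tplanar (nth tangle0 ps k).
Proof. by move=> h1 h2; case/planar_repsP: (codes_nth h1 h2). Qed.

Lemma assemble_tplanar m n I ps : (I, ps) \in codes m n -> tplanar (assemble (I, ps)).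
Proof.
move=> h; apply: fill_tplanar; last by move=> k; apply: codes_nth_tplanar h.
by move: h; rewrite codesP => /and3P[/irreducible_repsP[]].
Qed.

Lemma assemble_size m n I ps : (I, ps) \in codes m n -> tgsize (assemble (I, ps)) = n.
Proof.
rewrite codesP forestsP => /and3P[/irreducible_repsP[pI _ _ _ e] /and3P[/eqP sz _ /eqP sm] _].
have /andP[u _] := tplanar_valid pI.
rewrite tgsize_fill -sm sumnE big_map.
exact: (sum_labels_nth (R := nat) _ u e sz).
Qed.

Lemma assemble_num_matched m n I ps : (I, ps) \in codes m n ->
  num_matched (assemble (I, ps)) = 1 + \sum_(A <- ps) num_matched A.
Proof.
move=> h; have vn k : k \in leaves I.1 -> valid (nth tangle0 ps k).
  by move=> kI; apply/tplanar_valid/(codes_nth_tplanar h).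
move: h; rewrite codesP forestsP.
move=> /and3P[/irreducible_repsP[pI iI szI m1 e] /and3P[/eqP sz _ /eqP sm] _].
have vI := tplanar_valid pI; have /andP[u _] := vI.
rewrite num_matched_fill // (proj2 (num_matched_eq1 vI _)) ?szI //; congr addn.
exact: (sum_labels_nth (R := nat) _ u e sz).
Qed.

Definition cherry : btree nat := Node (Leaf 0) (Leaf 1).

Lemma tree_cherry (T : btree nat) : uniq (leaves T) -> leaves T =i iota 0 2 ->
  tree_sim T cherry.
Proof.
move=> u e; have p : perm_eq (leaves T) [:: 0; 1] by apply: uniq_perm.
have := perm_size p; case: T u e p => [a|l r] //= _ _ p.
have := size_leaves_gt0 l; have := size_leaves_gt0 r; rewrite size_cat => r0 l0 sz.
have [sl sr] : size (leaves l) = 1 /\ size (leaves r) = 1 by lia.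
have leaf (t : btree nat) : size (leaves t) = 1 -> exists a, t = Leaf a.
  case: t => [a|t1 t2] /=; first by exists a.
  by rewrite size_cat; have := size_leaves_gt0 t1; have := size_leaves_gt0 t2; lia.
have [a ea] := leaf _ sl; have [b eb] := leaf _ sr; move: p; rewrite ea eb /=.
move=> p; have := perm_mem p a; have := perm_mem p b; have := perm_uniq p.
by rewrite /= !inE !eqxx orbT /= andbT => h1 /esym/orP[]/eqP hb /esym/orP[]/eqP ha;
   move: h1; rewrite ha hb.
Qed.

Lemma tangle_cherry (I : tangle nat) : valid I -> leaves I.1 =i iota 0 2 ->
  tsim I (cherry, cherry).
Proof.
case/andP=> u p e; rewrite /tsim !tree_cherry // -?(perm_uniq p) //.
by move=> x; rewrite -(perm_mem p) e.
Qed.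

Lemma cherry_swap (I : tangle nat) : valid I -> leaves I.1 =i iota 0 2 ->
  tiso_by (subn 1) I I.
Proof.
move=> vI e; have s := tangle_cherry vI e; have s' := s; rewrite tsim_sym in s'.
by apply: tsim_trans s'; apply: tsim_trans (tsim_relabel _ s) _.
Qed.

(** There is a single tanglegram of size 2, and it is irreducible: the coefficient
    of x^2 in H is a convention and not this number. *)
Lemma size_irreducible_reps2 : size (irreducible_reps 2) = 1.
Proof.
have al : aligned (cherry, cherry) by [].
have pc : tplanar (cherry, cherry) by exists (cherry, cherry); rewrite ?tsim_refl.
have ic : tirreducible (cherry, cherry).
  by apply/num_matched_eq1 => //; rewrite /num_matched /= !internal_Node /= !big_seq1.
have [I Ir i] := @planar_reps_complete 2 _ _ pc erefl.
have II : I \in irreducible_reps 2.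
  apply: in_irreducible_reps => //; have [pI _ _] := planar_repsP Ir.
  by apply: tiso_irreducible i _ ic => //; apply: tplanar_valid.
have u : uniq (irreducible_reps 2) by rewrite filter_uniq ?planar_reps_uniq.
rewrite -(@perm_size _ [:: I]) //; apply: uniq_perm => // J.
rewrite mem_seq1; apply/eqP/idP => [->//|JJ].
have [pJ _ _ _ eJ] := irreducible_repsP JJ; have [pI _ _ _ eI] := irreducible_repsP II.
apply: (@planar_reps_inj 2) => //; first by move: JJ; rewrite mem_filter => /andP[].
exists id; rewrite /tiso_by relabel_tangle_id.
apply: tsim_trans (tangle_cherry (tplanar_valid pJ) eJ) _.
by rewrite tsim_sym (tangle_cherry (tplanar_valid pI) eI).
Qed.

(** The skeleton and the blocks of [A] are replaced by representatives, after
    renumbering the blocks along the isomorphism between the skeleton and its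
    representative.  If there are two blocks in the wrong order, they are
    exchanged by [cherry_swap]. *)
Lemma assemble_complete (L : eqType) (A : tangle L) n : tplanar A -> tgsize A = n -> 1 < n ->
  exists2 c, c \in all_codes n & tiso (assemble c) A.
Proof.
move=> pA szA n1; have vA := tplanar_valid pA; case: pA => A' al sA.
have szA' : tgsize A' = n by rewrite -(tsim_size sA).
have [|J [h [alJ iJ szJ alh eA]]] := decompose al; first by rewrite szA'.
have vJ := aligned_valid alJ.
have vh : {in leaves J.1, forall k, valid (h k)} by move=> b /alh /aligned_valid.
have pl (K : eqType) (B : tangle K) : aligned B -> tplanar B.
  by exists B; rewrite ?tsim_refl.
have [I Ir [s sI]] := planar_reps_complete (pl _ _ alJ) erefl.
set m := tgsize J in szJ Ir.
have [pI szI eI] := planar_repsP Ir; have vI := tplanar_valid pI.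
have iI : tirreducible I by apply: (tiso_irreducible vJ vI) => //; exists s.
have IrI := in_irreducible_reps Ir szJ iI.
have [s' [_ sK]] := tiso_by_inv vJ vI sI.
have [B BP] := @seq_choice _ _ tangle0
   (fun b B => B \in planar_reps (tgsize (h b)) /\ tiso (h b) B) (leaves J.1)
   (fun b bJ => let: ex_intro2 B p q := planar_reps_complete (pl _ _ (alh b bJ)) erefl
                in ex_intro _ B (conj p q)).
pose ps := mkseq (fun k => B (s' k)) m.
have nth_ps b : b \in leaves J.1 -> nth tangle0 ps (s b) = B b.
  move=> bJ; rewrite nth_mkseq ?sK //; have := tiso_by_in sI bJ.
  by rewrite eI mem_iota add0n.
have i1 : tiso (fill J h) (fill I (nth tangle0 ps)).
  by apply: fill_tiso sI _ => // b bJ; rewrite nth_ps //; have [] := BP b bJ.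
have pI1 := tiso_by_perm sI.
have vp : {in leaves I.1, forall k, valid (nth tangle0 ps k)}.
  move=> k; rewrite -(perm_mem pI1) => /mapP[b bJ ->]; rewrite nth_ps //.
  by have [/planar_repsP[/tplanar_valid]] := BP b bJ.
have vF := fill_valid vI vp; have vJF := fill_valid vJ vh.
have i2 : tiso (fill I (nth tangle0 ps)) A.
  apply: tiso_trans (tiso_sym vJF vF i1) _; exists snd.
  by rewrite /tiso_by eA tsim_sym.
have szp : size ps = m by rewrite size_mkseq.
have uI : uniq (leaves I.1) by case/andP: vI.
have fps : ps \in forests m n.
  rewrite forestsP szp eqxx /=; apply/andP; split.
    apply/allP => C /mapP[k]; rewrite -eI -(perm_mem pI1) => /mapP[b bJ ->] ->.
    by rewrite sK //; have [h1 _] := BP b bJ; rewrite (planar_reps_tgsize h1).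
  rewrite sumnE big_map -(sum_labels_nth (R := nat) _ uI eI szp).
  by rewrite -szA -(tiso_size i2) tgsize_fill.
have mn : m <= n.
  move: fps; rewrite forestsP => /and3P[/eqP <- _ /eqP <-].
  elim: (ps) => //= C qs IH; rewrite -add1n leq_add //; exact: size_leaves_gt0.
have in_all c : c \in codes m n -> c \in all_codes n.
  by move=> h1; apply/allpairsPdep; exists m, c; rewrite mem_iota add0n.
have [op|nop] := boolP (ordered ps).
  by exists (I, ps) => //; apply: in_all; rewrite codesP IrI fps.
move: nop; rewrite negb_imply szp => /andP[/eqP m2 nle].
exists (I, rev ps).
  apply: in_all; rewrite codesP IrI /=; apply/andP; split.
    move: fps; rewrite !forestsP size_rev /reps_forest all_rev map_rev sumn_rev //.
  rewrite /ordered size_rev szp m2 eqxx /= !nth_rev szp m2 // -?[2 - _]/_.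
  by rewrite subn1 subnn; apply: ltnW; rewrite ltnNge.
apply: tiso_trans i2; rewrite m2 in eI.
apply: (fill_tiso vI (cherry_swap vI eI)) => k kI; exists id.
rewrite /tiso_by relabel_tangle_id nth_rev szp m2; last first.
  by move: kI; rewrite eI mem_iota; case: k => [|[]].
rewrite (_ : 2 - k.+1 = 1 - k) ?tsim_refl //; lia.
Qed.

Lemma pickle_nat_inj : injective (pickle : tangle nat -> nat).
Proof. exact: pcan_inj pickleK. Qed.

(** The induced isomorphism [s] of skeletons makes the skeletons equal, since they
    are representatives; then [s] is an automorphism.  It is the identity by
    [rigid] for three leaves or more.  For two leaves it may be the exchange, but
    then [ordered] forces the two grafted tanglegrams to be equal. *)
Lemma assemble_inj n c c' : c \in all_codes n -> c' \in all_codes n ->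
  tiso (assemble c) (assemble c') -> c = c'.
Proof.
case: c c' => I ps [I' ps'].
case/allpairsPdep=> m [c [_ hc ec]] /allpairsPdep[m' [c' [_ hc' ec']]].
rewrite -{c}ec in hc; rewrite -{c'}ec' in hc'.
have vp k : k \in leaves I.1 -> valid (nth tangle0 ps k).
  by move=> kI; apply/tplanar_valid/(codes_nth_tplanar hc).
have vp' k : k \in leaves I'.1 -> valid (nth tangle0 ps' k).
  by move=> kI; apply/tplanar_valid/(codes_nth_tplanar hc').
have rp k := codes_nth (k := k) hc; have rp' k := codes_nth (k := k) hc'.
move: hc hc'; rewrite !codesP => /and3P[hI hps op] /and3P[hI' hps' op'].
have [pI iI szI m1 eI] := irreducible_repsP hI.
have [pI' iI' szI' m1' eI'] := irreducible_repsP hI'.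
have vI := tplanar_valid pI; have vI' := tplanar_valid pI'.
case/(fill_tiso_inv vI iI _ vp vI' iI' _ vp'); rewrite ?szI ?szI' // => s sI i.
have em : m' = m by rewrite -szI -szI' (tiso_size (ex_intro _ s sI)).
rewrite {m'}em in hI' hps' m1' szI' eI'.
have eII : I = I'.
  apply: (@planar_reps_inj m); last by exists s.
    by move: hI; rewrite mem_filter => /andP[].
  by move: hI'; rewrite mem_filter => /andP[].
rewrite -{}eII {I' hI' pI' iI' szI' eI' vI'} in sI vp' rp' *.
have [sz sz'] : size ps = m /\ size ps' = m.
  by move: hps hps'; rewrite !forestsP => /and3P[/eqP-> _ _] /and3P[/eqP-> _ _].
have sin k : k \in leaves I.1 -> s k \in leaves I.1 by move=> kI; apply: tiso_by_in sI kI.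
have eq k : k \in leaves I.1 -> nth tangle0 ps k = nth tangle0 ps' (s k).
  move=> kI; have h := i k kI; apply: (planar_reps_inj (rp k kI)) => //.
  by rewrite (tiso_size h); apply/rp'/sin.
congr pair.
suff h k : k < m -> nth tangle0 ps k = nth tangle0 ps' k.
  by apply: (@eq_from_nth _ tangle0); rewrite ?sz ?sz'.
have inI k' : (k' \in leaves I.1) = (k' < m) by rewrite eI mem_iota add0n.
move=> km; have kI : k \in leaves I.1 by rewrite inI.
have [m2|m3] := leqP m 2; last first.
  have := rigid pI iI; rewrite szI => /(_ s m3 sI k kI) sk.
  by rewrite eq // sk.
have m2' : m = 2 by lia.
rewrite m2' in inI sz sz' km.
have i0 : 0 \in leaves I.1 by rewrite inI. have i1 : 1 \in leaves I.1 by rewrite inI.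
have s01 : s 0 != s 1.
  by apply/eqP => /(tiso_by_inj vI sI i0 i1).
have s0 := sin 0 i0; have s1 := sin 1 i1; rewrite !inI in s0 s1.
have e0 := eq 0 i0; have e1 := eq 1 i1.
move: op op'; rewrite /ordered sz sz' /= e0 e1.
case: (s 0) s0 s01 e0 => [|[]] // _; case: (s 1) s1 e1 => [|[]] // _ e1 _ e0.
  by move=> _ _; case: k km kI => [|[]].
move=> le1 le2; have e : nth tangle0 ps' 0 = nth tangle0 ps' 1.
  by apply: pickle_nat_inj; apply/eqP; rewrite eqn_leq le1 le2.
by case: k km kI => [|[]] // _ _; rewrite ?e0 ?e1 e.
Qed.

Lemma all_codes_uniq n : uniq (all_codes n).
Proof.
apply: (@uniq_flatten_key _ (fun c => size c.2)); first exact: iota_uniq.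
- move=> m _; rewrite map_id; apply: allpairs_uniq => [||[a b] [c d] _ _ /= [-> ->]] //.
    by rewrite filter_uniq ?planar_reps_uniq.
  by rewrite filter_uniq ?forests_uniq.
- move=> m _ [I ps]; rewrite map_id codesP forestsP.
  by case/and3P=> _ /and3P[/eqP].
Qed.

Local Open Scope ring_scope.

(** * Generating functions *)

Lemma F_planar_reps (n : nat) : F n = \sum_(A <- planar_reps n) 'X ^+ num_matched A.
Proof.
rewrite /F big_map big_filter big_enum_cond; apply: eq_bigr => c _.
by rewrite nat_tangle_num_matched.
Qed.

Lemma H_irreducible_reps (n : nat) : n != 2%N -> H n = (size (irreducible_reps n))%:R.
Proof.
move=> /negbTE n2; rewrite /H n2; congr (_%:R).
rewrite size_filter -sum1_count big_map big_filter_cond big_enum_cond -sum1_card.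
apply: eq_bigl => c; by rewrite inE irreducible_num_matched num_matched_ord -nat_tangle_num_matched.
Qed.

(** Composites and representatives are related by isomorphism only, so the
    bijection is given as a relation. *)
Lemma sum_bijection (V : nmodType) (X Y : eqType) (R : X -> Y -> Prop)
    (s : seq X) (t : seq Y) (v : X -> V) (w : Y -> V) : uniq s -> uniq t ->
  (forall x, x \in s -> exists2 y, y \in t & R x y) ->
  (forall y, y \in t -> exists2 x, x \in s & R x y) ->
  (forall x y, x \in s -> y \in t -> R x y -> v x = w y) ->
  (forall x x' y, x \in s -> x' \in s -> y \in t -> R x y -> R x' y -> x = x') ->
  (forall x y y', x \in s -> y \in t -> y' \in t -> R x y -> R x y' -> y = y') ->
  \sum_(x <- s) v x = \sum_(y <- t) w y.
Proof.
move=> us ut sur1 sur2 vw inj1 inj2; case: t ut sur1 sur2 vw inj1 inj2 => [|y0 t'] ut.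
  case: s us => [|x s'] _ h; first by rewrite !big_nil.
  by have [] := h x (mem_head _ _).
set t := y0 :: t' in ut * => sur1 sur2 vw inj1 inj2.
have [h hP] := @seq_choice _ _ y0 (fun x y => y \in t /\ R x y) s
  (fun x xs => let: ex_intro2 y a b := sur1 x xs in ex_intro _ y (conj a b)).
have p : perm_eq (map h s) t.
  apply: uniq_perm => //.
    rewrite map_inj_in_uniq // => x x' xs xs' e.
    have [a b] := hP x xs; have [a' b'] := hP x' xs'.
    by apply: (inj1 _ _ (h x)) => //; rewrite e.
  move=> y; apply/mapP/idP => [[x /hP[a _] -> //]|yt].
  have [x xs Rxy] := sur2 y yt; exists x => //.
  by have [a b] := hP x xs; apply: (inj2 x).
rewrite -(perm_big _ p) big_map; apply: eq_big_seq => x xs.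
by have [a b] := hP x xs; apply: vw.
Qed.

Definition forest_weight (ps : seq (tangle nat)) : {poly rat} :=
  'X ^+ (\sum_(A <- ps) num_matched A)%N.

(** Assembling is a bijection between codes and classes of planar tanglegrams, and
    the factor q stands for the pair of roots. *)
Lemma F_codes (n : nat) : (1 < n)%N ->
  F n = \sum_(m < n.+1) \sum_(c <- codes m n) 'X * forest_weight c.2.
Proof.
move=> n1; rewrite -(big_mkord xpredT (fun m => \sum_(c <- codes m n) 'X * forest_weight c.2)).
transitivity (\sum_(c <- all_codes n) 'X * forest_weight c.2); last first.
  by rewrite big_allpairs_dep /index_iota subn0.
rewrite F_planar_reps; apply/esym.
have cP c : c \in all_codes n -> exists m, (c.1, c.2) \in codes m n.
  by case/allpairsPdep=> m [d [_ h ->]]; exists m; case: d h.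
have cT c : c \in all_codes n -> tplanar (assemble c).
  by case: c => I ps /cP[m] /= /assemble_tplanar.
have cV c : c \in all_codes n -> valid (assemble c) by move=> /cT /tplanar_valid.
have rV A : A \in planar_reps n -> valid A.
  by case/planar_repsP => /tplanar_valid.
apply: (@sum_bijection _ _ _ (fun c A => tiso (assemble c) A)).
- exact: all_codes_uniq.
- exact: planar_reps_uniq.
- move=> c cA; apply: planar_reps_complete; first exact: cT.
  by case: c cA => I ps /cP[m] /= /assemble_size.
- by move=> A /planar_repsP[pA sz _]; apply: assemble_complete.
- move=> c A cA AR i; rewrite /= -(tiso_num_matched (cV _ cA) (rV _ AR) i).
  case: c cA {i} => I ps /cP[m] /= /assemble_num_matched ->.
  by rewrite exprD expr1.
- move=> c c' A cA cA' AR i i'; apply: (assemble_inj cA cA').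
  by apply: tiso_trans i _; apply: tiso_sym i'; rewrite ?cV ?rV.
- move=> c A A' cA AR AR' i i'; apply: (planar_reps_inj AR AR').
  by apply: tiso_trans i'; apply: tiso_sym i; rewrite ?cV ?rV.
Qed.

Lemma exp_forests m n : fps_exp F m n = \sum_(ps <- forests m n) forest_weight ps.
Proof.
elim: m n => [|m IH] n.
  rewrite /= /fps_one; case: n => [|n] /=; last by rewrite big_nil.
  by rewrite big_seq1 /forest_weight big_nil.
rewrite [LHS]/= /fps_mul big_allpairs_dep -[iota 0 n.+1]/(index_iota 0 n.+1) big_mkord.
apply: eq_bigr => i _; rewrite big_allpairs F_planar_reps IH mulr_suml.
apply: eq_bigr => A _; rewrite mulr_sumr; apply: eq_bigr => ps _.
by rewrite /forest_weight /= big_cons exprD.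
Qed.

Lemma codes_sum m n : m != 2%N ->
  \sum_(c <- codes m n) 'X * forest_weight c.2 = 'X * (H m * fps_exp F m n).
Proof.
move=> m2; rewrite H_irreducible_reps // big_allpairs exp_forests.
rewrite (eq_big_seq (fun I => 'X * \sum_(ps <- forests m n) forest_weight ps)).
  by rewrite big_const_seq count_predT iter_addr_0 mulr_natl -mulrnAr.
move=> I _; rewrite mulr_sumr /= big_filter big_seq_cond [RHS]big_seq.
apply: eq_bigl => ps; rewrite forestsP /ordered.
by case: eqP => [->|] //=; rewrite (negbTE m2) andbT.
Qed.

(** The pairs of equal tanglegrams: the sizes and the numbers of leaf-matched pairs
    are doubled. *)
Lemma double_forests n :
  \sum_(ps <- forests 2 n | nth tangle0 ps 0 == nth tangle0 ps 1) forest_weight ps =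
  fps_double F n.
Proof.
pose s := if odd n then [::] else map (fun A => [:: A; A]) (planar_reps n./2).
rewrite -big_filter (@perm_big _ _ _ _ _ s); last first.
  apply: uniq_perm; rewrite ?filter_uniq ?forests_uniq //.
    by rewrite /s; case: ifP => // _; rewrite map_inj_uniq ?planar_reps_uniq // => A B [].
  move=> ps; rewrite mem_filter forestsP /s; apply/idP/idP.
    case: ps => [|A [|B []]] /=; rewrite ?andbF // => /andP[/eqP<-].
    rewrite andbT andbb addn0 => /andP[h /eqP e].
    have on : odd n = false by rewrite -e addnn odd_double.
    by rewrite on map_f // -e addnn doubleK.
  case: ifP => // on /mapP[A hA ->] /=; rewrite eqxx (planar_reps_tgsize hA) hA /=.
  by rewrite addn0 addnn -[X in _ == X]odd_double_half on.
rewrite /s /fps_double; case: ifP => _; first by rewrite big_nil.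
rewrite big_map F_planar_reps rmorph_sum /=; apply: eq_bigr => A _.
by rewrite /forest_weight big_cons big_seq1 comp_Xn_poly -exprM mul2n addnn.
Qed.

Lemma forest_weight_rev ps : forest_weight (rev ps) = forest_weight ps.
Proof. by rewrite /forest_weight (perm_big ps) // perm_rev. Qed.

(** Ordered pairs modulo exchange: with x the sum over strictly increasing pairs
    and y the sum over diagonal pairs, F^2 has the coefficient 2x + y, while the
    codes contribute x + y. *)
Lemma codes2_sum n :
  \sum_(c <- codes 2 n) 'X * forest_weight c.2 =
  'X * (H 2 * fps_exp F 2 n) + (2%:R^-1 : rat)%:P * 'X * fps_double F n.
Proof.
rewrite big_allpairs.
have -> : irreducible_reps 2 = [:: head tangle0 (irreducible_reps 2)].
  by case: irreducible_reps size_irreducible_reps2 => // I [].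
have -> : H 2 = (2%:R^-1 : rat)%:P by [].
rewrite big_seq1 [LHS]/= -mulr_sumr big_filter exp_forests -double_forests.
set W := forests 2 n; pose a (ps : seq (tangle nat)) := pickle (nth tangle0 ps 0).
pose b (ps : seq (tangle nat)) := pickle (nth tangle0 ps 1).
have szW ps : ps \in W -> size ps = 2 by rewrite forestsP => /and3P[/eqP].
have rW : perm_eq (map rev W) W.
  apply: uniq_perm; rewrite ?map_inj_uniq ?forests_uniq //; try exact: can_inj (@revK _).
  have rin ps : ps \in W -> rev ps \in W.
    by rewrite !forestsP size_rev /reps_forest all_rev map_rev sumn_rev.
  move=> ps; apply/mapP/idP => [[qs /rin h -> //]|/rin h].
  by exists (rev ps); rewrite ?revK.
pose S (P : pred (seq (tangle nat))) := \sum_(ps <- W | P ps) forest_weight ps.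
have eqS (P Q : pred (seq (tangle nat))) : {in W, P =1 Q} -> S P = S Q.
  move=> PQ; rewrite /S big_seq_cond [RHS]big_seq_cond; apply: eq_bigl => ps.
  by case h : (ps \in W) => //=; apply: PQ.
have lt_gt : S (fun ps => b ps < a ps)%N = S (fun ps => a ps < b ps)%N.
  rewrite {1}/S -(perm_big _ rW) big_map; under eq_bigr do rewrite forest_weight_rev.
  apply: eqS => ps /szW sz; rewrite /a /b !nth_rev sz //.
have split1 : S xpredT = S (fun ps => a ps <= b ps)%N + S (fun ps => b ps < a ps)%N.
  rewrite {1}/S (bigID (fun ps => a ps <= b ps)%N) /=; congr (_ + _).
  by apply: eq_bigl => ps; rewrite ltnNge.
have split2 : S (fun ps => a ps <= b ps)%N =
    S (fun ps => a ps < b ps)%N + S (fun ps => nth tangle0 ps 0 == nth tangle0 ps 1).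
  rewrite {1}/S (bigID (fun ps => a ps < b ps)%N) /=; congr (_ + _); apply: eq_bigl => ps.
    by apply: andb_idl => /ltnW.
  by rewrite -leqNgt -eqn_leq (inj_eq pickle_nat_inj).
have -> : \sum_(ps <- W | ordered ps) forest_weight ps = S (fun ps => a ps <= b ps)%N.
  by apply: eqS => ps /szW sz; rewrite /ordered sz.
rewrite -/(S xpredT) -/(S (fun ps => nth tangle0 ps 0 == nth tangle0 ps 1)).
rewrite split1 lt_gt split2.
set x := S _; set y := S _.
have half : (2%:R^-1 : rat)%:P * 2%:R = 1 :> {poly rat}.
  by rewrite -polyC_natr -polyCM mulVf.
rewrite -[LHS]mul1r -half; ring.
Qed.

Lemma F_1 : F 1 = 1.
Proof.
have sz1 (T : btree nat) : size (leaves T) = 1%N -> exists a, T = Leaf a.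
  case: T => [a|l r] /=; first by exists a.
  by rewrite size_cat; have := size_leaves_gt0 l; have := size_leaves_gt0 r; lia.
have one A : A \in planar_reps 1 -> A = tangle0.
  case: A => T S /planar_repsP[/tplanar_valid/andP[/= u p] sz e].
  have [a eT] := sz1 T sz; have [|b eS] := sz1 S; first by rewrite -(perm_size p).
  move: p e; rewrite eT eS /= => /perm_mem p e.
  have a0 := e 0%N; rewrite !mem_seq1 eqxx in a0.
  have b0 := esym (p 0%N); rewrite !mem_seq1 a0 in b0.
  by rewrite -(eqP a0) -(eqP b0).
have [B Br _] : exists2 B, B \in planar_reps 1 & tiso tangle0 B.
  by apply: planar_reps_complete => //; exists tangle0; rewrite ?tsim_refl.
have e : perm_eq (planar_reps 1) [:: tangle0].
  apply: uniq_perm; rewrite ?planar_reps_uniq // => A; rewrite mem_seq1.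
  by apply/idP/eqP => [/one|->] //; rewrite -(one B Br).
by rewrite F_planar_reps (perm_big _ e) big_seq1 /num_matched big_nil expr0.
Qed.

Lemma H_small (m : nat) : (m < 2)%N -> H m = 0.
Proof.
move=> m2; rewrite H_irreducible_reps; last by rewrite neq_ltn m2.
rewrite /irreducible_reps (eq_filter (a2 := pred0)) ?filter_pred0 // => A /=.
by rewrite ltnNge -ltnS m2.
Qed.

Theorem theorem1p2 :
  F =1 fps_add (fps_add (fps_x {poly rat}) (fps_scale 'X (fps_comp H F)))
               (fps_scale ((2%:R^-1 : rat)%:P * 'X) (fps_double F)).
Proof.
move=> n; rewrite /fps_add /fps_scale /fps_x /fps_comp.
have [n1|n2] := leqP n 1.
  rewrite big1 => [|m _]; last first.
    by rewrite H_small ?mul0r // (leq_trans (ltn_ord m)).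
  case: n n1 => [|[]] // _; rewrite /fps_double /= ?F_0 ?F_1.
    by rewrite comp_poly0 !mulr0 !addr0.
  by rewrite !mulr0 !addr0.
have /negbTE-> : n != 1%N by rewrite neq_ltn n2 orbT.
rewrite add0r F_codes //.
have [i2 i2E] : exists i : 'I_n.+1, i = 2%N :> nat by exists (inord 2); rewrite inordK.
rewrite mulr_sumr (bigD1 i2) //= [in RHS](bigD1 i2) //= !i2E codes2_sum addrAC.
congr (_ + _ + _); apply: eq_bigr => m ne; apply: codes_sum.
by apply: contra ne => /eqP e; apply/eqP/ord_inj; rewrite e i2E.
Qed.
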